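(* A maximal matching in an $n$-node graph $G=(V,E)$ of maximum degree $\Delta$ can be computed deterministically in $O(\log^2\Delta\cdot\log n)$ rounds in the $\mathsf{CONGEST}$ model.
   Context: $\mathsf{CONGEST}$ model: the network is $G$; nodes have unique $O(\log n)$-bit identifiers; in each synchronous round each node may send an $O(\log n)$-bit message to each neighbor; at the end each node knows which of its incident edges are in the matching. A maximal matching is a set of pairwise disjoint edges such that every edge of $G$ shares an endpoint with some edge of the set. *)

(* Defs.v *)
From mathcomp Require Import all_boot.
Set Implicit Arguments.
Unset Strict Implicit.
Unset Printing Implicit Defensive.

(* Ceiling of the binary logarithm, clamped below at 1 so that an
   O(log ...) bound is never the degenerate bound 0 at arguments 0 and 1. *)
Definition lg (k : nat) : nat := up_log 2 (maxn 2 k).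

Section Graph.
Variables (V : finType) (e : rel V).

Definition simple_graph : Prop := symmetric e /\ irreflexive e.

Definition edges : {set {set V}} :=
  [set [set p.1; p.2] | p : V * V in [pred p | e p.1 p.2]].

Definition max_degree : nat := \max_(v : V) #|e v|.

Definition maximal_matching (M : {set {set V}}) : Prop :=
  [/\ M \subset edges,
      trivIset M
    & forall f, f \in edges -> exists2 g, g \in M & ~~ [disjoint f & g]].

End Graph.

(* A deterministic node program with messages of at most [b] bits.  A node
   starts out knowing only its degree and its identifier; it addresses its
   incident edges by local port numbers 0, ..., degree - 1.  The empty message
   stands for silence.  [output s = Some o] means that a node in state [s] has
   halted, [o i] telling whether the edge at port [i] is selected. *)
Record node_program (b : nat) := NodeProgram {
  state : Type;
  init : nat -> nat -> state;                 (* degree, identifier *)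
  send : state -> nat -> b.-bseq bool;        (* message put on a port *)
  receive : state -> seq (b.-bseq bool) -> state; (* inbox, in port order *)
  output : state -> option (pred nat)
}.

Section Execution.
Variables (V : finType) (e : rel V) (id : V -> nat) (port : V -> seq V).

Definition valid_ids (c : nat) : Prop :=
  injective id /\ forall v, id v < 2 ^ (c * lg #|V|).

(* [nth _ (port v) i] is the neighbour of [v] at its port [i]; the numberings
   at the two endpoints of an edge are unrelated. *)
Definition valid_ports : Prop :=
  forall v, uniq (port v) /\ port v =i e v.

Variables (b : nat) (A : node_program b).

Definition halted (s : state A) : bool := isSome (output s).

Definition message (s : V -> state A) (u v : V) : b.-bseq bool :=
  if halted (s u) then [bseq] else send (s u) (index v (port u)).

Definition round (s : V -> state A) : V -> state A := fun v =>
  if halted (s v) then s v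
  else receive (s v) [seq message s u v | u <- port v].

Definition run (t : nat) : V -> state A :=
  iter t round (fun v => init A (size (port v)) (id v)).

(* After [t] rounds every node has halted, knowing which of its incident edges
   belong to [M]. *)
Definition computes_edge_set (t : nat) (M : {set {set V}}) : Prop :=
  forall v, exists2 o, output (run t v) = Some o &
    forall i, i < size (port v) -> o i = ([set v; nth v (port v) i] \in M).

End Execution.

(* Main.v *)
Require Import Defs.
From mathcomp Require Import all_boot.
From mathcomp Require Import all_order all_algebra.
From mathcomp Require Import zify ring lra.
Set Implicit Arguments.
Unset Strict Implicit.
Unset Printing Implicit Defensive.

(** The degree bound is guessed as 2^(2^k), k = 0, 1, ...; the rounds of the
    guesses grow geometrically, so the last one dominates.  Within a guess 2^l,
    orient each edge towards its larger identifier.  An iteration computes a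
    fractional matching on the arcs, with separate constraints for the outgoing
    and the incoming arcs of a vertex, by doubling all arcs with two slack
    endpoints; its value is proportional to the maximum matching size nu.  It is
    then rounded in O(l) steps, each setting every arc of the least value h to 0
    or 2h: a vertex splits its incoming arcs evenly into O(l) classes, processed
    in turn, and the tail of each arc of the current class decides by the method
    of conditional expectations for the potential "value minus weighted number
    of conflicting pairs".  Only the pairs with a common head and class are
    decided independently, so a step costs a 1/O(l) fraction of the conflicts.
    The conflict-free arcs left at the end form directed paths, and a maximal
    matching of them removes a constant fraction of nu; so O(log n) iterations
    of O(l^2) rounds suffice.  Symmetry on the paths is broken by one
    Cole-Vishkin step and the O(log log n) bits of the resulting colours.  When
    this is not O(l), 4^l times it is O(log n), and one matches instead, for each
    pair of port numbers, the directed paths formed by the arcs with these ports. *)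

(** * Sums of products over pairs of distinct indices *)

Section PairSum.
Import Order.TTheory GRing.Theory Num.Theory.
Local Open Scope ring_scope.
Variable V : finType.
Implicit Types f g : V -> int.

(** This is the sum of [f u * f w] over ordered pairs of distinct [u] and [w], put in a form that
    expands algebraically. *)
Definition psum f : int := (\sum_u f u) ^+ 2 - \sum_u f u ^+ 2.

Lemma eq_psum f g : f =1 g -> psum f = psum g.
Proof.
move=> fg; rewrite /psum; congr (_ ^+ 2 - _); apply: eq_bigr => u _; by rewrite fg.
Qed.

Lemma psumE f : psum f = \sum_u f u * (\sum_w f w - f u).
Proof.
rewrite /psum expr2 mulr_suml -sumrB; apply: eq_bigr => u _; ring.
Qed.

Lemma psumD f g :
  psum (fun u => f u + g u) =
  psum f + 2 * (\sum_u g u * (\sum_w f w - f u)) + psum g.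
Proof.
rewrite /psum big_split /=.
have -> : \sum_u (f u + g u) ^+ 2 =
    \sum_u f u ^+ 2 + \sum_u g u ^+ 2 + 2 * \sum_u g u * f u.
  by rewrite mulr_sumr -!big_split /=; apply: eq_bigr => u _; ring.
have -> : \sum_u g u * (\sum_w f w - f u) =
    (\sum_u g u) * (\sum_w f w) - \sum_u g u * f u.
  by rewrite mulr_suml -sumrB; apply: eq_bigr => u _; ring.
ring.
Qed.

Lemma psum_le_sqr f : (forall u, 0 <= f u) -> psum f <= (\sum_u f u) ^+ 2.
Proof.
move=> f0; rewrite /psum lerBlDr lerDl; apply: sumr_ge0 => u _; exact: sqr_ge0.
Qed.

(** Only the pairs inside the level set of [h] are kept; each contributes [h ^ 2], and the discarded
    products are nonnegative. *)
Lemma psum_ge f (h : nat) : (forall u, 0 <= f u) ->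
  h%:Z ^+ 2 * (#|[set u | f u == h%:Z]| * #|[set u | f u == h%:Z]|.-1)%:Z
   <= psum f.
Proof.
move=> f0; set A := [set u | _].
have sA : \sum_(u in A) f u = #|A|%:Z * h%:Z.
  rewrite (eq_bigr (fun=> h%:Z)) ?sumr_const => [|u]; last by rewrite inE => /eqP.
  by rewrite -mulr_natl natz.
have leA : #|A|%:Z * h%:Z <= \sum_u f u.
  by rewrite -sA [leRHS](bigID (mem A)) /= lerDl sumr_ge0.
have leS u : f u <= \sum_w f w.
  by rewrite (bigD1 u) //= lerDl sumr_ge0.
rewrite psumE (bigID (mem A)) /=.
apply: (@le_trans _ _ (\sum_(u in A) h%:Z * (h%:Z * #|A|.-1%:Z))).
  rewrite sumr_const -mulr_natl natz.
  by rewrite le_eqVlt; apply/orP; left; apply/eqP; rewrite PoszM; ring.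
rewrite -[leLHS]addr0; apply: lerD; last first.
  by apply: sumr_ge0 => u _; rewrite mulr_ge0 // subr_ge0.
apply: ler_sum => u uA; have fu : f u = h%:Z by move: uA; rewrite inE => /eqP.
rewrite fu; apply: ler_wpM2l => //.
have AE : #|A| = #|A|.-1.+1 by rewrite prednK // card_gt0; apply/set0Pn; exists u.
rewrite lerBrDr; apply: le_trans leA; rewrite {2}AE intS mulrDl mul1r addrC lerD2l.
by rewrite mulrC.
Qed.

(** The sum of squares is known exactly, and the square of the sum is largest when all signs
    agree. *)
Lemma psum_sign_le f (h : nat) (A : pred V) :
  (forall u, A u -> f u = h%:Z \/ f u = - h%:Z) -> (forall u, ~~ A u -> f u = 0) ->
  psum f <= h%:Z ^+ 2 * (#|A| * #|A|.-1)%:Z.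
Proof.
move=> fA fN; rewrite /psum.
have s2 : \sum_u f u ^+ 2 = #|A|%:Z * h%:Z ^+ 2.
  rewrite (bigID A) /= [X in _ + X]big1 ?addr0; last by move=> u /fN ->; rewrite expr0n.
  rewrite (eq_bigr (fun=> h%:Z ^+ 2)) ?sumr_const => [|u /fA [] ->]; rewrite ?sqrrN //.
  by rewrite -mulr_natl natz.
have s1 : `|\sum_u f u| <= #|A|%:Z * h%:Z.
  apply: le_trans (ler_norm_sum _ _ _) _.
  rewrite (bigID A) /= [X in _ + X]big1 ?addr0; last by move=> u /fN ->; rewrite normr0.
  rewrite (eq_bigr (fun=> h%:Z)) ?sumr_const => [|u /fA [] ->]; rewrite ?normrN //.
  by rewrite -mulr_natl natz.
have s1' : (\sum_u f u) ^+ 2 <= (#|A|%:Z * h%:Z) ^+ 2.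
  by rewrite -real_normK ?num_real // ler_sqr ?nnegrE ?mulr_ge0.
rewrite s2; apply: le_trans (lerB s1' (lexx _)) _.
case: #|A| => [|k] /=; first by rewrite !mul0r mul0n mulr0 expr0n.
by rewrite le_eqVlt; apply/orP; left; apply/eqP; rewrite PoszM; ring.
Qed.

End PairSum.

(** * The potential and its change when one class of arcs is settled *)

Section Potential.
Import Order.TTheory GRing.Theory Num.Theory.
Local Open Scope ring_scope.
Variable V : finType.
Implicit Types X : V -> V -> nat.

Definition outs X u : nat := (\sum_v X u v)%N.
Definition ins X v : nat := (\sum_u X u v)%N.
Definition volume X : nat := (\sum_u outs X u)%N.

Definition pout X : int := \sum_u psum (fun v => (X u v)%:Z).
Definition pin X : int := \sum_v psum (fun u => (X u v)%:Z).

(** A conflict is a pair of arcs with a common tail ([pout]) or a common head ([pin]), weighted by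
    the product of their values. *)
Definition potential (a q : int) X : int :=
  a * (volume X)%:Z - q * (pout X + pin X).

Lemma volume_ins X : volume X = (\sum_v ins X v)%N.
Proof. by rewrite /volume /outs /ins exchange_big. Qed.

Lemma PoszS (I : Type) (r : seq I) (P : pred I) (F : I -> nat) :
  (\sum_(i <- r | P i) F i)%N%:Z = \sum_(i <- r | P i) (F i)%:Z.
Proof. by elim/big_rec2: _ => // i y x _ <-. Qed.

(* The gain of the vertex [u] when the in-sums of the class arcs are frozen. *)
Definition tail_gain (a q : int) (R : V -> int) (x : V -> nat) : int :=
  a * (\sum_v (x v)%:Z) - q * psum (fun v => (x v)%:Z)
  - 2 * q * (\sum_v (x v)%:Z * R v).

(** The tails decide independently, each seeing the conflicts at the heads to first order only. The
    error is the second-order term, which involves just the pairs of arcs with the same head and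
    class, each changing by [h] in absolute value. *)
Lemma potential_class_step (a : int) (q h : nat) (cl : rel V) X X' :
  (forall u v, ~~ cl u v -> X' u v = X u v) ->
  (forall u v, cl u v -> X u v = h) ->
  (forall u v, cl u v -> X' u v = 0%N \/ X' u v = h.*2) ->
  (forall u, let R v := if cl u v then (ins X v - h)%N%:Z else 0 in
     tail_gain a q%:Z R (X u) <= tail_gain a q%:Z R (X' u)) ->
  potential a q%:Z X <= potential a q%:Z X' + q%:Z * h%:Z ^+ 2 *
     (\sum_v #|cl^~ v| * #|cl^~ v|.-1)%N%:Z.
Proof.
move=> XN Xh X'h gain.
pose R u v : int := if cl u v then (ins X v - h)%N%:Z else 0.
pose D u v : int := (X' u v)%:Z - (X u v)%:Z.
have DN u v : ~~ cl u v -> D u v = 0 by move=> /XN XE; rewrite /D XE subrr.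
have DA u v : cl u v -> D u v = h%:Z \/ D u v = - h%:Z.
  move=> cuv; rewrite /D (Xh u v cuv); case: (X'h u v cuv) => ->; [right|left]; lia.
(* Expansion around [X]: on a class arc [R] is the in-sum without the arc's own value [h], so the
   linear term is the one that [tail_gain] accounts for. *)
have pinE : pin X' = pin X + 2 * (\sum_u \sum_v D u v * R u v) +
    \sum_v psum (fun u => D u v).
  rewrite exchange_big mulr_sumr -!big_split /=; apply: eq_bigr => v _.
  rewrite (@eq_psum _ _ (fun u => (X u v)%:Z + D u v)); last by move=> u; rewrite /D; ring.
  rewrite psumD; congr (_ + 2 * _ + _); apply: eq_bigr => u _.
  rewrite /R; case: ifPn => [cuv|/DN -> ]; last by rewrite !mul0r.
  rewrite -PoszS -/(ins X v) (Xh u v cuv) subzn //.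
  by rewrite /ins (bigD1 u) //= (Xh u v cuv) leq_addr.
have pDle : \sum_v psum (fun u => D u v) <=
    h%:Z ^+ 2 * (\sum_v #|cl^~ v| * #|cl^~ v|.-1)%N%:Z.
  rewrite PoszS mulr_sumr; apply: ler_sum => v _.
  by apply: psum_sign_le => u; [exact: DA | exact: DN].
have gainS : \sum_u tail_gain a q%:Z (R u) (X u) <= \sum_u tail_gain a q%:Z (R u) (X' u).
  by apply: ler_sum => u _; exact: gain.
have sumE Z : \sum_u tail_gain a q%:Z (R u) (Z u) =
    a * (volume Z)%:Z - q%:Z * pout Z - 2 * q%:Z * \sum_u \sum_v (Z u v)%:Z * R u v.
  rewrite /tail_gain 2!big_split /= !sumrN -!mulr_sumr; congr (a * _ - _ - _).
  by rewrite /volume PoszS; apply: eq_bigr => u _; rewrite /outs PoszS.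
have DRE : \sum_u \sum_v D u v * R u v =
    \sum_u \sum_v (X' u v)%:Z * R u v - \sum_u \sum_v (X u v)%:Z * R u v.
  rewrite -sumrB; apply: eq_bigr => u _; rewrite -sumrB; apply: eq_bigr => v _.
  by rewrite /D mulrBl.
rewrite !sumE in gainS.
rewrite /potential pinE DRE.
have q0 : 0 <= q%:Z by [].
move: (ler_wpM2l q0 pDle).
set u1 := \sum_u \sum_v _ * _ in gainS *; set u2 := \sum_u \sum_v _ * _ in gainS *.
set u3 := \sum_v psum _; set u4 := (\sum_v _)%N%:Z.
move=> pD; lra.
Qed.

End Potential.

(** Numbering the selected positions and reducing modulo [L] puts at least [L - 1] selected
    positions between two consecutive members of a class. *)
Lemma modular_class_balanced (s : pred nat) (L b d : nat) : b < L ->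
  L * (count (fun p => s p && (count s (iota 0 p) %% L == b)) (iota 0 d)).-1
   <= (count s (iota 0 d)).-1.
Proof.
move=> bL; set cls := fun p => _.
(* The members of the class have ranks [b], [b + L], and so on; this form of the bound also covers
   the empty class, where it reduces to [b < L]. *)
have H : L * count cls (iota 0 d) + b < count s (iota 0 d) + L.
  elim: d => [|d IH]; first by rewrite /= muln0.
  rewrite -[d.+1]addn1 iotaD !count_cat /= !addn0 add0n.
  rewrite /cls in IH *; case sd: (s d) => /=; last by rewrite !addn0.
  case: eqP => [rb|_] /=; last by lia.
  move: IH; set r := count s _ in rb *; set m := count _ _ => IH.
  have rE := divn_eq r L; rewrite rb in rE.
  have : L * m < (r %/ L).+1 * L by lia.
  by rewrite [L * m]mulnC ltn_mul2r => /andP[_]; rewrite ltnS => mr; nia.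
case: (count cls _) H => [|m] /= H; first by rewrite muln0.
by nia.
Qed.

(** * Fractional matchings by doubling, and their comparison with integral ones *)

Section Fractional.
Variable V : finType.
Implicit Types (X : V -> V -> nat) (act : rel V) (N M : {set V * V}).

Lemma outs_ge X u v : X u v <= outs X u.
Proof. by rewrite /outs (bigD1 v) //= leq_addr. Qed.

Section ClassLoss.
Import Order.TTheory GRing.Theory Num.Theory.
Local Open Scope ring_scope.

(** By balance, an arc meets in its own class at most a [1 / L] fraction of the other arcs of value
    [h] with the same head, and all pairs of such arcs are counted in [pin]. *)
Lemma class_loss_le (lab : V -> V -> nat) (h L : nat) X :
  (forall u v, (lab v u < L)%N = (X u v == h)) ->
  (forall v b, (b < L)%N -> (L * #|[pred u | lab v u == b]|.-1 <=
      #|[set u | X u v == h]|.-1)%N) ->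
  L%:Z * (h%:Z ^+ 2 * (\sum_(b < L) \sum_v
     #|[pred u | lab v u == b]| * #|[pred u | lab v u == b]|.-1)%N%:Z) <= pin X.
Proof.
move=> labL bal.
have cardE v : #|[set u | X u v == h]| = (\sum_(b < L) #|[pred u | lab v u == b]|)%N.
  rewrite cardsE -sum1_card.
  rewrite (eq_bigl (fun u => (lab v u < L)%N)); last by move=> u; rewrite labL.
  rewrite (eq_bigr (fun b : 'I_L => \sum_(u | lab v u == b) 1)%N); last first.
    by move=> b _; rewrite sum1_card.
  rewrite (exchange_big_dep (fun u => (lab v u < L)%N)) /=; last first.
    by move=> b u _ /eqP ->.
  apply: eq_bigr => u lu; rewrite (bigD1 (Ordinal lu)) //= big1 ?addn0 // => b.
  by case/andP=> /eqP lE; case/eqP; apply: val_inj.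
have H v : (\sum_(b < L) #|[pred u | lab v u == b]|
     * (L * #|[pred u | lab v u == b]|.-1) <=
     #|[set u | X u v == h]| * #|[set u | X u v == h]|.-1)%N.
  rewrite [X in (_ <= X * _)%N]cardE big_distrl /=; apply: leq_sum => b _.
  by rewrite leq_mul2l bal ?orbT.
rewrite mulrCA.
set S := (\sum_(b < L) _)%N.
have -> : L%:Z * S%:Z
   = (\sum_v \sum_(b < L) #|[pred u | lab v u == b]| * (L * #|[pred u | lab v u == b]|.-1))%N%:Z.
  rewrite -PoszM /S; congr Posz.
  rewrite exchange_big big_distrr /=; apply: eq_bigr => v _.
  by rewrite big_distrr /=; apply: eq_bigr => b _; rewrite mulnCA.
rewrite PoszS mulr_sumr; apply: ler_sum => v _.
apply: le_trans (psum_ge h _); last by [].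
apply: ler_wpM2l; first exact: sqr_ge0.
have -> : #|[set u | (X u v)%:Z == h%:Z]| = #|[set u | X u v == h]|.
  by apply: eq_card => u; rewrite !inE eqz_nat.
by rewrite lez_nat.
Qed.

End ClassLoss.

Definition doubled T X u v :=
  if (2 * outs X u <= T) && (2 * ins X v <= T) then 2 * X u v else X u v.

(** The last clause records progress: an arc has been doubled in all [r] rounds unless one of its
    endpoints is already more than half full. *)
Definition fractional_inv act T r X :=
  [/\ forall u, outs X u <= T, forall v, ins X v <= T,
      forall u v, act u v -> exists j, X u v = 2 ^ j,
      forall u v, ~~ act u v -> X u v = 0
    & forall u v, act u v -> [|| X u v == 2 ^ r, T < 2 * outs X u | T < 2 * ins X v]].

Lemma doubled_ge T X u v : X u v <= doubled T X u v.
Proof. by rewrite /doubled; case: ifP => // _; rewrite leq_pmull. Qed.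

(** A slack sum at most doubles and a sum that is not slack is frozen, so the bound [T] persists;
    values never decrease, so an endpoint more than half full stays so. *)
Lemma fractional_inv_doubled act T r X X' :
  (forall u v, X' u v = doubled T X u v) ->
  fractional_inv act T r X -> fractional_inv act T r.+1 X'.
Proof.
move=> X'E [oT iT Xp X0 Xc].
have oge u : outs X u <= outs X' u.
  by apply: leq_sum => v _; rewrite X'E doubled_ge.
have ige v : ins X v <= ins X' v.
  by apply: leq_sum => u _; rewrite X'E doubled_ge.
split=> [u|v|u v auv|u v nuv|u v auv].
- case: (leqP (2 * outs X u) T) => hu.
    apply: leq_trans hu; rewrite /outs big_distrr /=; apply: leq_sum => v _.
    by rewrite X'E /doubled; case: ifP => // _; rewrite leq_pmull.
  rewrite [outs X' u](_ : _ = outs X u) //; apply: eq_bigr => v _.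
  by rewrite X'E /doubled leqNgt hu.
- case: (leqP (2 * ins X v) T) => hu.
    apply: leq_trans hu; rewrite /ins big_distrr /=; apply: leq_sum => u _.
    by rewrite X'E /doubled; case: ifP => // _; rewrite leq_pmull.
  rewrite [ins X' v](_ : _ = ins X v) //; apply: eq_bigr => u _.
  by rewrite X'E /doubled [2 * ins X v <= T]leqNgt hu andbF.
- case: (Xp u v auv) => j Xj; rewrite X'E /doubled Xj; case: ifP => _; last by exists j.
  by exists j.+1; rewrite expnS.
- by rewrite X'E /doubled X0 //; case: ifP.
- rewrite X'E /doubled; case: (leqP (2 * outs X u) T) => hu /=; last first.
    have -> : T < 2 * outs X' u by apply: leq_trans hu _; rewrite leq_mul2l oge.
    by rewrite orbT.
  case: (leqP (2 * ins X v) T) => hv /=; last first.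
    have -> : T < 2 * ins X' v by apply: leq_trans hv _; rewrite leq_mul2l ige.
    by rewrite !orbT.
  have := Xc u v auv; rewrite !ltnNge hu hv /= orbF => /eqP ->.
  by rewrite expnS eqxx.
Qed.

Definition touch (w : V) (x : V * V) := (w == x.1) || (w == x.2).

(** Disjointness is undirected here, whereas the fractional constraints treat the two roles of a
    vertex separately. *)
Definition arc_matching act N :=
  [forall x in N, act x.1 x.2 &&
    [forall y in N, [forall w, touch w x ==> touch w y ==> (x == y)]]].

Lemma arc_matchingP act N :
  reflect ((forall x, x \in N -> act x.1 x.2) /\
     (forall x y w, x \in N -> y \in N -> touch w x -> touch w y -> x = y))
   (arc_matching act N).
Proof.
apply: (iffP forall_inP) => [H|[Ha Hd] x xN].
  split=> [x xN|x y w xN yN wx wy]; first by case/andP: (H x xN).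
  case/andP: (H x xN) => _ /forall_inP /(_ y yN) /forallP /(_ w).
  by rewrite wx wy => /eqP.
rewrite Ha //=; apply/forall_inP => y yN; apply/forallP => w.
by apply/implyP => wx; apply/implyP => wy; rewrite (Hd x y w).
Qed.

Definition nu act := \max_(N : {set V * V} | arc_matching act N) #|N|.

Lemma nu_le act : nu act <= #|V|.
Proof.
apply/bigmax_leqP => N /arc_matchingP[_ Nd].
rewrite -(card_in_imset (f := fst)) ?max_card // => x y xN yN xy.
by apply: (Nd x y x.1); rewrite // /touch -?xy eqxx.
Qed.

Lemma nu_eq0 act : nu act = 0 -> forall u v, ~~ act u v.
Proof.
move=> n0 u v; apply/negP => auv.
have : #|[set (u, v)]| <= nu act.
  apply: (leq_bigmax_cond (F := fun N : {set V * V} => #|N|)); apply/arc_matchingP; split.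
    by move=> x /set1P ->.
  by move=> x y w /set1P -> /set1P ->.
by rewrite n0 cards1.
Qed.

(** A largest matching of the remaining arcs together with [M] is still a matching of [act]. *)
Lemma nu_removed act act' M : arc_matching act M -> subrel act' act ->
  (forall u v w x, act' u v -> x \in M -> touch w (u, v) -> ~~ touch w x) ->
  nu act' + #|M| <= nu act.
Proof.
move=> /arc_matchingP[Ma Md] sub away.
case: (@eq_bigmax_cond _ (arc_matching act') (fun N : {set V * V} => #|N|)).
  apply/card_gt0P; exists set0; apply/arc_matchingP.
  by split=> [x|x y w]; rewrite inE.
move=> N /arc_matchingP[Na Nd]; rewrite -/(nu act') => ->.
have Naway x y w : x \in N -> y \in M -> touch w x -> ~~ touch w y.
  by case: x => u v xN yM; apply: (away u v) => //; exact: Na xN.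
have dis : #|N :&: M| = 0.
  apply/eqP; rewrite cards_eq0; apply/eqP/setP => x; rewrite !inE; apply/negP => /andP[xN xM].
  by have := Naway x x x.1 xN xM; rewrite /touch eqxx /= => /(_ isT).
have := cardsUI N M; rewrite dis addn0 => <-.
apply: (leq_bigmax_cond (F := fun N : {set V * V} => #|N|)); apply/arc_matchingP; split.
  by move=> x /setUP[/Na/sub|/Ma].
move=> x y w /setUP[xN|xM] /setUP[yN|yM] wx wy; first exact: (Nd x y w).
- by move: (Naway x y w xN yM wx); rewrite wy.
- by move: (Naway y x w yN xM wy); rewrite wx.
- exact: (Md x y w).
Qed.

Lemma sum_arc_matching act N (F G : V -> nat) : arc_matching act N ->
  \sum_(x in N) (F x.1 + G x.2) <= \sum_u F u + \sum_v G v.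
Proof.
case/arc_matchingP=> _ Nd; rewrite big_split /=; apply: leq_add.
  rewrite -(big_imset (h := fst) F (A := mem N)) /=; last first.
    move=> x y xN yN xy; apply: (Nd x y x.1) => //; by rewrite /touch -?xy eqxx.
  rewrite [leqRHS](bigID (mem [set x.1 | x in N])) /=; exact: leq_addr.
rewrite -(big_imset (h := snd) G (A := mem N)) /=; last first.
  move=> x y xN yN xy; apply: (Nd x y x.2) => //; by rewrite /touch -?xy eqxx orbT.
rewrite [leqRHS](bigID (mem [set x.2 | x in N])) /=; exact: leq_addr.
Qed.

(** No value can reach [2 ^ r > T], so every arc has an endpoint more than half full. Each arc of a
    matching charges [T] to twice the sums at its ends; the factor 4 is 2 for half full times 2 for
    counting the volume by tails and by heads. *)
Lemma fractional_total act T r X : fractional_inv act T r X -> T < 2 ^ r ->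
  T * nu act <= 4 * volume X.
Proof.
case=> oT iT Xp X0 Xc Tr; rewrite /nu.
elim/big_ind: _ => [|x y hx hy|N Nm]; first by rewrite muln0.
  by rewrite maxnMr geq_max hx hy.
have [Na _] := arc_matchingP _ _ Nm.
have : \sum_(x in N) T <= \sum_(x in N) (2 * outs X x.1 + 2 * ins X x.2).
  apply: leq_sum => -[u v] xN /=; have auv := Na _ xN.
  have /or3P[/eqP Xr|h|h] := Xc _ _ auv.
  - by have := leq_trans (outs_ge X u v) (oT u); rewrite Xr leqNgt Tr.
  - by rewrite (leq_trans (ltnW h)) ?leq_addr.
  - by rewrite (leq_trans (ltnW h)) ?leq_addl.
rewrite sum_nat_const mulnC => h; apply: leq_trans h _.
apply: leq_trans (sum_arc_matching (fun u => 2 * outs X u) (fun v => 2 * ins X v) Nm) _.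
by rewrite -!big_distrr /= -volume_ins -/(volume X); lia.
Qed.

Definition outdeg X u := #|[pred v | X u v != 0]|.
Definition indeg X v := #|[pred u | X u v != 0]|.
Definition unique_arc X u v := [&& X u v != 0, outdeg X u == 1 & indeg X v == 1].

(** An arc that is not unique is charged to a conflicting pair at its tail or at its head. *)
Lemma unique_arc_card X :
  \sum_u outdeg X u <= #|[set x : V * V | unique_arc X x.1 x.2]| +
    (\sum_u outdeg X u * (outdeg X u).-1 + \sum_v indeg X v * (indeg X v).-1).
Proof.
have outE u : outdeg X u = \sum_v (X u v != 0) by rewrite /outdeg -sum1_card big_mkcond.
have inE' v : indeg X v = \sum_u (X u v != 0) by rewrite /indeg -sum1_card big_mkcond.
have -> : #|[set x : V * V | unique_arc X x.1 x.2]| = \sum_u \sum_v unique_arc X u v.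
  by rewrite pair_big /= cardsE -sum1_card big_mkcond.
have -> : \sum_u outdeg X u * (outdeg X u).-1 =
    \sum_u \sum_v (X u v != 0) * (outdeg X u).-1.
  by apply: eq_bigr => u _; rewrite -big_distrl /= -outE.
have -> : \sum_v indeg X v * (indeg X v).-1 =
    \sum_u \sum_v (X u v != 0) * (indeg X v).-1.
  by rewrite exchange_big; apply: eq_bigr => v _; rewrite -big_distrl /= -inE'.
rewrite -!big_split /=; apply: leq_sum => u _.
rewrite {1}outE -!big_split /=; apply: leq_sum => v _.
rewrite /unique_arc; case Xuv: (X u v == 0) => //=; rewrite !mul1n.
have : 0 < outdeg X u by apply/card_gt0P; exists v; rewrite inE Xuv.
have : 0 < indeg X v by apply/card_gt0P; exists u; rewrite inE Xuv.
by case: (outdeg X u) => [|[|m]] //; case: (indeg X v) => [|[|m']].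
Qed.

End Fractional.

(** * The potential along the rounding, and the matching extracted at its end *)

Section Rounding.
Variable V : finType.
Implicit Types (X : V -> V -> nat) (act : rel V).
Import Order.TTheory GRing.Theory Num.Theory.
Local Open Scope ring_scope.

Lemma pin_ge0 X : 0 <= pin X.
Proof.
apply: sumr_ge0 => v _.
by apply: le_trans (psum_ge 0%N (f := fun u => (X u v)%:Z) _).
Qed.

Lemma pout_ge0 X : 0 <= pout X.
Proof.
apply: sumr_ge0 => u _.
by apply: le_trans (psum_ge 0%N (f := fun v => (X u v)%:Z) _).
Qed.

Lemma pin_le X T : (forall v, (ins X v <= T)%N) -> pin X <= (T * volume X)%N%:Z.
Proof.
move=> iT; rewrite volume_ins big_distrr /= PoszS; apply: ler_sum => v _.
apply: le_trans (psum_le_sqr _) _ => //; rewrite -PoszS -/(ins X v).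
by rewrite expr2 -PoszM lez_nat leq_mul2r iT orbT.
Qed.

Lemma pout_le X T : (forall u, (outs X u <= T)%N) -> pout X <= (T * volume X)%N%:Z.
Proof.
move=> oT; rewrite big_distrr /= PoszS; apply: ler_sum => u _.
apply: le_trans (psum_le_sqr _) _ => //; rewrite -PoszS -/(outs X u).
by rewrite expr2 -PoszM lez_nat leq_mul2r oT orbT.
Qed.

(* The weight of the conflicts decreases from (1 + 1/L)^K to 1 during the K
   rounding steps; this pays for the loss of each step. *)
Definition pot (L K i : nat) X : int :=
  potential ((L ^ (K - i) * 2 ^ K)%N%:Z) ((L.+1 ^ (K - i))%N%:Z) X.

(** Passing to [i.+1] divides the value weight by [L] and the conflict weight by [L.+1]. The surplus
    [q * pin X] freed in this way pays for the loss [L * (q * S)]. *)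
Lemma pot_step L K i X X' (S : int) : (i < K)%N ->
  let a := (L ^ (K - i.+1) * 2 ^ K)%N%:Z in let q := (L.+1 ^ (K - i.+1))%N%:Z in
  potential a q X <= potential a q X' + q * S -> L%:Z * S <= pin X ->
  pot L K i X <= L%:Z * pot L K i.+1 X'.
Proof.
move=> iK a q H1 H2; rewrite /pot -/a -/q.
have -> : (K - i = (K - i.+1).+1)%N by rewrite subnSK.
have -> : (L ^ (K - i.+1).+1 * 2 ^ K)%N%:Z = L%:Z * a by rewrite -PoszM expnS mulnA.
have -> : (L.+1 ^ (K - i.+1).+1)%N%:Z = (L%:Z + 1) * q by rewrite expnS PoszM; congr (_ * _); lia.
have po := pout_ge0 X.
have q0 : 0 <= q by [].
have L0 : 0 <= L%:Z by [].
have := ler_wpM2l L0 H1; have := ler_wpM2l q0 H2; have := mulr_ge0 q0 po.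
clearbody a q; rewrite /potential => h1 h2 h3; clear H1 H2 q0 po L0.
lra.
Qed.

(** Up to the factor [L ^ K] the value term is [8 * T * volume X]. The conflicts are at most
    [2 * T * volume X], and their weight is at most twice [L ^ K], so half of the value term
    survives. *)
Lemma pot_start act T r X L K : fractional_inv act T r X -> (2 ^ K = 8 * T)%N ->
  (L.+1 ^ K <= 2 * L ^ K)%N ->
  (L ^ K * (4 * T * volume X))%N%:Z <= pot L K 0 X.
Proof.
case=> oT iT _ _ _ KT LK; rewrite /pot /potential subn0 KT.
have h1 := pout_le oT; have h2 := pin_le iT.
have h3 : pout X + pin X <= 2 * (T * volume X)%N%:Z by lra.
have h4 := ler_wpM2l (isT : 0 <= (L.+1 ^ K)%N%:Z) h3.
have h5 : (L.+1 ^ K)%N%:Z * (2 * (T * volume X)%N%:Z) <=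
   (2 * L ^ K)%N%:Z * (2 * (T * volume X)%N%:Z) by rewrite ler_wpM2r.
have h := le_trans h4 h5.
have -> : (L ^ K * (4 * T * volume X))%N%:Z = (L ^ K * (8 * T))%N%:Z * (volume X)%:Z -
   (2 * L ^ K)%N%:Z * (2 * (T * volume X)%N%:Z) by rewrite !PoszM; ring.
by rewrite lerB.
Qed.

(** For a two-valued [X] the potential is [H ^ 2] times the number of arcs minus the number of
    conflicts, which [unique_arc_card] bounds. *)
Lemma potential_extract X H : (forall u v, X u v = 0%N \/ X u v = H) ->
  potential H%:Z 1 X <= (H ^ 2 * #|[set x : V * V | unique_arc X x.1 x.2]|)%N%:Z.
Proof.
move=> XH.
have pE (f : V -> nat) : (forall u, f u = 0%N \/ f u = H) -> (0 < H)%N ->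
    psum (fun u => (f u)%:Z) =
     (H ^ 2 * (#|[pred u | f u != 0%N]| * #|[pred u | f u != 0%N]|.-1))%N%:Z.
  move=> fH H0; rewrite /psum -PoszS.
  have fE u : f u = (H * (f u != 0))%N.
    by case: (fH u) => ->; rewrite ?eqxx ?muln0 // -lt0n H0 muln1.
  have -> : (\sum_u f u = H * #|[pred u | f u != 0%N]|)%N.
    rewrite -sum1_card [in RHS]big_mkcond big_distrr /=.
    by apply: eq_bigr => u _; rewrite {1}fE inE; case: (f u != 0%N).
  have -> : \sum_u (f u)%:Z ^+ 2 = (H ^ 2 * #|[pred u | f u != 0%N]|)%N%:Z.
    rewrite -sum1_card [in RHS]big_mkcond big_distrr /= PoszS.
    apply: eq_bigr => u _; rewrite {1}fE inE; case: (f u != 0%N) => /=.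
      by rewrite !muln1 expr2 -PoszM -mulnn.
    by rewrite !muln0 expr0n.
  move: #|_| => [|k] /=; first by rewrite !muln0 expr0n.
  by rewrite !PoszM intS; ring.
have [->|H0] := posnP H; first by rewrite /potential mul0r sub0r mul1r oppr_le0 addr_ge0 ?pout_ge0 ?pin_ge0.
rewrite {1}/potential.
have -> : volume X = (H * \sum_u outdeg X u)%N.
  rewrite /volume big_distrr /=; apply: eq_bigr => u _; rewrite /outs /outdeg.
  rewrite -sum1_card [in RHS]big_mkcond big_distrr /=; apply: eq_bigr => v _.
  by rewrite inE; case: (XH u v) => ->; rewrite ?eqxx ?muln0 // -lt0n H0 muln1.
have -> : pout X = (H ^ 2 * \sum_u outdeg X u * (outdeg X u).-1)%N%:Z.
  by rewrite big_distrr PoszS; apply: eq_bigr => u _; rewrite pE.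
have -> : pin X = (H ^ 2 * \sum_v indeg X v * (indeg X v).-1)%N%:Z.
  by rewrite big_distrr PoszS; apply: eq_bigr => v _; rewrite pE.
have := unique_arc_card X; rewrite -(leq_pmul2l (_ : (0 < H ^ 2)%N)) ?expn_gt0 ?H0 //.
rewrite !mulnDr -PoszM mulnA mulnn.
move: (H ^ 2 * _)%N (H ^ 2 * _)%N (H ^ 2 * _)%N (H ^ 2 * _)%N => a1 a2 a3 a4; lia.
Qed.

(** Every arc meets one of the two endpoints of an element of [M], and a vertex lies on at most one
    outgoing and one incoming arc. *)
Lemma arc_card_le X (M : {set V * V}) : (forall u, (outdeg X u <= 1)%N) -> (forall v, (indeg X v <= 1)%N) ->
  (forall u v, X u v != 0%N -> exists2 x, x \in M & touch u x || touch v x) ->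
  (#|[set x : V * V | X x.1 x.2 != 0%N]| <= 4 * #|M|)%N.
Proof.
move=> o1 i1 XM.
pose around w := [set x : V * V | (X x.1 x.2 != 0%N) && touch w x].
have aw w : (#|around w| <= 2)%N.
  have -> : around w = [set x : V * V | (X x.1 x.2 != 0%N) && (w == x.1)] :|:
    [set x : V * V | (X x.1 x.2 != 0%N) && (w == x.2)].
    by apply/setP => x; rewrite !inE /touch andb_orr.
  apply: leq_trans (leq_card_setU _ _) _; rewrite -[2%N]/(1 + 1)%N; apply: leq_add.
    apply: leq_trans (o1 w); rewrite -(card_in_imset (f := snd)).
      apply: subset_leq_card; apply/subsetP => v /imsetP[[a b]]; rewrite !inE /=.
      by case/andP=> Xab /eqP -> ->.
    by move=> [a b] [a' b']; rewrite !inE /= => /andP[_ /eqP <-] /andP[_ /eqP <-] ->.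
  apply: leq_trans (i1 w); rewrite -(card_in_imset (f := fst)).
    apply: subset_leq_card; apply/subsetP => v /imsetP[[a b]]; rewrite !inE /=.
    by case/andP=> Xab /eqP -> ->.
  by move=> [a b] [a' b']; rewrite !inE /= => /andP[_ /eqP <-] /andP[_ /eqP <-] ->.
have sub : [set x : V * V | X x.1 x.2 != 0%N] \subset
    \bigcup_(x in M) (around x.1 :|: around x.2).
  apply/subsetP => -[u v]; rewrite inE => /= Xuv; have [x xM] := XM u v Xuv => tx.
  apply/bigcupP; exists x => //; rewrite !inE /touch /= Xuv /=.
  by move: tx; rewrite /touch ![u == _]eq_sym ![v == _]eq_sym; do 4 case: (_ == _).
apply: leq_trans (subset_leq_card sub) _.
apply: (@leq_trans (\sum_(x in M) #|around x.1 :|: around x.2|)).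
  elim/big_rec2: _ => [|x k A _ le]; first by rewrite cards0.
  by apply: leq_trans (leq_card_setU _ _) _; rewrite leq_add2l.
rewrite mulnC -sum_nat_const; apply: leq_sum => x _.
by apply: leq_trans (leq_card_setU _ _) _; rewrite -[4%N]/(2 + 2)%N leq_add.
Qed.

End Rounding.

(** This is why [2 * K] classes are used: the conflict weight then grows by a factor of at most 2
    over the [K] rounding steps. *)
Lemma inverse_bernoulli K : (2 * K).+1 ^ K <= 2 * (2 * K) ^ K.
Proof.
(* Bernoulli's inequality for [(1 - 1/(m+1))^j], cleared of denominators. *)
have H m j : j <= m -> m.+1 ^ j * (m.+1 - j) <= m ^ j * m.+1.
  elim: j => [|j IH] jm; first by rewrite !expn0 subn0 mulnC.
  have := IH (ltnW jm); have [d mE] : exists d, m = j + d by exists (m - j); lia.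
  have -> : m.+1 - j = d.+1 by lia.
  have -> : m.+1 - j.+1 = d by lia.
  rewrite !expnS; move: (m.+1 ^ j) (m ^ j) => A B h.
  have := leq_mul (leqnn m) h.
  have : A * (m.+1 * d) <= A * (m * d.+1) by rewrite leq_mul2l; apply/orP; right; lia.
  lia.
have [->|K0] := posnP K; first by [].
have := H (2 * K) K (leq_pmull _ _) => /(_ isT).
have -> : (2 * K).+1 - K = K.+1 by lia.
set a := _ ^ _; set b := _ ^ _ => h.
have := leq_mul (leqnn 2) h; nia.
Qed.

(** Bernoulli's inequality for [(1 + 1/m)^m]; with [m = 255] it shows that 256 shrinkings by
    [255/256] at least halve a quantity. *)
Lemma double_expn m : 2 * m ^ m.+1 <= m.+1 ^ m.+1.
Proof.
have H j : m ^ j * (m + j) <= m.+1 ^ j * m.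
  elim: j => [|j IH]; first by rewrite !expn0 addn0.
  rewrite !expnS; move: (m.+1 ^ j) (m ^ j) IH => A B h.
  have := leq_mul (leqnn m.+1) h; lia.
have := H m; rewrite !expnS; lia.
Qed.

(** * Binary digits and the encoding of numbers as messages *)

Definition bit (j m : nat) : bool := odd (m %/ 2 ^ j).

Lemma bit0 m : bit 0 m = odd m.
Proof. by rewrite /bit divn1. Qed.

Lemma bitS j m : bit j.+1 m = bit j m./2.
Proof. by rewrite /bit expnS divnMA divn2. Qed.

Lemma bits_inj b m k : m < 2 ^ b -> k < 2 ^ b ->
  (forall j, j < b -> bit j m = bit j k) -> m = k.
Proof.
elim: b m k => [|b IH] m k; first by case: m k => [|m] [|k].
rewrite expnS => mb kb E; rewrite -[m]odd_double_half -[k]odd_double_half.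
have -> : odd m = odd k by rewrite -!bit0 E.
rewrite (IH m./2 k./2) // => [||j jb]; [lia | lia |].
by rewrite -!bitS E.
Qed.

Fixpoint encode (b m : nat) : bitseq :=
  if b is b'.+1 then odd m :: encode b' m./2 else [::].

(** The empty message decodes to 0, so a halted neighbour reads as one that sends 0. *)
Definition decode (l : bitseq) : nat := foldr (fun (x : bool) a => x + a.*2) 0 l.

Lemma size_encode b m : size (encode b m) <= b.
Proof. by elim: b m => //= b IH m; rewrite ltnS. Qed.

Lemma encodeK b m : m < 2 ^ b -> decode (encode b m) = m.
Proof.
elim: b m => [|b IH] m; first by case: m.
by rewrite expnS => mb; rewrite /= IH ?odd_double_half //; lia.
Qed.

Definition encoded (b m : nat) : b.-bseq bool := Bseq (size_encode b m).

(** * Node memory and the elementary steps of the program *)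

Record node := Node {
  deg : nat;
  ident : nat;
  nbr_id : nat -> nat;
  nbr_col : nat -> nat;
  mate : option nat;
  label : nat -> nat;
  stopped : bool }.

(* [xout p] is the value of the arc leaving through port [p], and [xin p] the
   local copy of the value of the arc entering through port [p]. *)
Record local_state := LocalState {
  base : node;
  xout : nat -> nat;
  xin : nat -> nat }.
Implicit Types (s : local_state) (r : nat -> nat).

(** One round, with numbers in place of bit strings; [program] does the translation once for all
    steps. *)
Record step := Step {
  emit : local_state -> nat -> nat;
  absorb : local_state -> (nat -> nat) -> local_state }.

Definition set_base (f : node -> node) s := LocalState (f (base s)) (xout s) (xin s).
Definition set_nbr_id r (z : node) :=
  Node (deg z) (ident z) r (nbr_col z) (mate z) (label z) (stopped z).
Definition set_nbr_col r (z : node) :=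
  Node (deg z) (ident z) (nbr_id z) r (mate z) (label z) (stopped z).
Definition set_mate o (z : node) :=
  Node (deg z) (ident z) (nbr_id z) (nbr_col z) o (label z) (stopped z).
Definition set_label f (z : node) :=
  Node (deg z) (ident z) (nbr_id z) (nbr_col z) (mate z) f (stopped z).
Definition set_stopped b (z : node) :=
  Node (deg z) (ident z) (nbr_id z) (nbr_col z) (mate z) (label z) b.

Definition initial_state (d i : nat) : local_state :=
  LocalState (Node d i (fun _ => 0) (fun _ => 0) None (fun _ => 0) false)
    (fun _ => 0) (fun _ => 0).

Definition dg s := deg (base s).
Definition unmatched s : bool := mate (base s) == None.
Definition sum_ports s (f : nat -> nat) : nat := \sum_(0 <= p < dg s) f p.
Definition count_ports s (f : nat -> nat) : nat := \sum_(0 <= p < dg s) (f p != 0).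

Definition exchange_ids : step :=
  Step (fun s _ => ident (base s)) (fun s r => set_base (set_nbr_id r) s).

Definition update_out (e : local_state -> nat -> nat)
    (f : local_state -> (nat -> nat) -> nat -> nat) : step :=
  Step e (fun s r => LocalState (base s) (f s r) (xin s)).

Definition send_values : step :=
  Step (fun s p => xout s p) (fun s r => LocalState (base s) (xout s) r).

Definition light (l : nat) s : bool := unmatched s && (dg s <= 2 ^ l).

(** With [predT] twice, every edge with two light ends becomes an arc. With two singletons a vertex
    keeps at most one outgoing and one incoming arc. *)
Definition activate (l : nat) (tail_port head_port : pred nat) : step :=
  update_out (fun s p => light l s && head_port p)
    (fun s r p => [&& p < dg s, light l s, tail_port p, r p == 1
       & ident (base s) < nbr_id (base s) p]).

Definition grow (T : nat) : step :=
  update_out (fun s _ => (2 * sum_ports s (xin s) <= T) : nat)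
    (fun s r p => if (2 * sum_ports s (xout s) <= T) && (r p == 1)
       then 2 * xout s p else xout s p).

(** The value [L] marks ports outside all classes; the ports of value [h] are dealt out to the
    classes in rotation. *)
Definition label_class (h L : nat) : step :=
  Step (fun _ _ => 0) (fun s _ => set_base (set_label (fun p =>
    if (p < dg s) && (xin s p == h)
    then count (fun p' => xin s p' == h) (iota 0 p) %% L else L)) s).

(** * The choice of a tail by conditional expectations *)

Section Greedy.
Import Order.TTheory GRing.Theory Num.Theory.
Local Open Scope ring_scope.

(** The local form of [tail_gain], indexed by port numbers so that a node can evaluate it. *)
Definition port_gain (d : nat) (a q : int) (R : nat -> int) (x : nat -> nat) : int :=
  a * (\sum_(0 <= p < d) (x p)%:Z)
  - q * ((\sum_(0 <= p < d) (x p)%:Z) ^+ 2 - \sum_(0 <= p < d) (x p)%:Z ^+ 2)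
  - 2 * q * (\sum_(0 <= p < d) (x p)%:Z * R p).

Definition upd (x : nat -> nat) (p m : nat) : nat -> nat :=
  fun p' => if p' == p then m else x p'.

Definition settle (g : (nat -> nat) -> int) (h : nat) (x : nat -> nat) (p : nat) :=
  if g x <= g (upd x p h.*2) then upd x p h.*2 else upd x p 0%N.

Definition greedy d a q h R (cl : pred nat) (x : nat -> nat) :=
  foldl (settle (port_gain d a q R) h) x (filter cl (iota 0 d)).

Lemma port_gain_affine d a q R x p h : (p < d)%N -> x p = h ->
  port_gain d a q R (upd x p h.*2) + port_gain d a q R (upd x p 0%N) =
  2 * port_gain d a q R x.
Proof.
move=> pd xp.
have S (G : nat -> nat -> int) m : \sum_(0 <= p' < d) G p' (upd x p m p') =
    G p m + \sum_(0 <= p' < d | p' != p) G p' (x p').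
  rewrite (bigD1_seq p) ?mem_index_iota ?iota_uniq //= /upd eqxx; congr (_ + _).
  by apply: eq_bigr => p' /negbTE ->.
have S0 (G : nat -> nat -> int) : \sum_(0 <= p' < d) G p' (x p') =
    G p h + \sum_(0 <= p' < d | p' != p) G p' (x p').
  by rewrite (bigD1_seq p) ?mem_index_iota ?iota_uniq //= xp.
rewrite /port_gain !(S (fun _ y => y%:Z)) !(S (fun _ y => y%:Z ^+ 2)).
rewrite !(S (fun p' y => y%:Z * R p')) (S0 (fun _ y => y%:Z)).
rewrite (S0 (fun _ y => y%:Z ^+ 2)) (S0 (fun p' y => y%:Z * R p')).
have -> : h.*2%:Z = 2 * h%:Z by rewrite -mul2n PoszM.
ring.
Qed.

Lemma greedyP d a q h R (cl : pred nat) x : (forall p, (p < d)%N -> cl p -> x p = h) ->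
  let y := greedy d a q h R cl x in
  [/\ port_gain d a q R x <= port_gain d a q R y,
      forall p, ~~ ((p < d)%N && cl p) -> y p = x p
    & forall p, (p < d)%N -> cl p -> y p = 0%N \/ y p = h.*2].
Proof.
move=> xh; rewrite /greedy; set l := filter _ _.
have lE p : (p \in l) = (p < d)%N && cl p by rewrite mem_filter mem_iota andbC.
have : uniq l by rewrite filter_uniq // iota_uniq.
suff H : forall x, uniq l -> (forall p, p \in l -> (p < d)%N /\ x p = h) ->
    let y := foldl (settle (port_gain d a q R) h) x l in
    [/\ port_gain d a q R x <= port_gain d a q R y,
      forall p, p \notin l -> y p = x p
    & forall p, p \in l -> y p = 0%N \/ y p = h.*2].
  move=> ul; have [|H1 H2 H3] := H x ul.
    by move=> p; rewrite lE => /andP[pd cp]; split=> //; exact: xh.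
  split=> // [p|p pd cp]; first by rewrite -lE => /H2.
  by apply: H3; rewrite lE pd.
elim: l {lE} => //= p l IH {xh}x /andP[pl ul] xl.
have [pd xp] := xl p (mem_head _ _).
set z := settle _ _ _ _.
have zE p' : p' != p -> z p' = x p'.
  by rewrite /z /settle /upd; case: ifP => _ /negbTE ->.
have zp : z p = 0%N \/ z p = h.*2.
  by rewrite /z /settle /upd; case: ifP => _; rewrite eqxx; [right|left].
have gz : port_gain d a q R x <= port_gain d a q R z.
  rewrite /z /settle; case: ifP => // /negbT; rewrite -ltNge => gx.
  have := port_gain_affine a q R pd xp; lra.
have [|H1 H2 H3] := IH z ul.
  move=> p' p'l; have [|p'd xp'] := xl p'; first by rewrite inE p'l orbT.
  by rewrite zE //; apply: contraNneq pl => <-.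
split=> [|p'|p']; first exact: le_trans gz H1.
  by rewrite inE negb_or => /andP[p'p p'l]; rewrite H2 // zE.
rewrite inE => /orP[/eqP ->|/H3 //]; by rewrite H2.
Qed.

End Greedy.

(** The head adds one to its in-sum so that 0 can mean that the port is outside class [b]; the tail
    removes this one and its own [h] to get the load of the other arcs. The weights are those of
    [pot] at [i.+1]. *)
Definition split_class (h L K i b : nat) : step :=
  update_out (fun s p => if label (base s) p == b then (sum_ports s (xin s)).+1 else 0)
    (fun s r => greedy (dg s) (Posz (L ^ (K - i.+1) * 2 ^ K)%N) (Posz (L.+1 ^ (K - i.+1))%N) h
       (fun p => Posz (if r p != 0 then (r p).-1 - h else 0)%N) (fun p => r p != 0) (xout s)).

Definition isolate : step :=
  update_out (fun s _ => (count_ports s (xin s) == 1) : nat)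
    (fun s r p => [&& xout s p != 0, count_ports s (xout s) == 1 & r p == 1]).

(** The result is the degree, an invalid port, when no arc leaves. *)
Definition out_port s : nat := find (fun p => xout s p != 0) (iota 0 (dg s)).

Definition first_diff (w m k : nat) : nat :=
  find (fun j => bit j m != bit j k) (iota 0 w).

(* One step of Cole and Vishkin's colour reduction along the outgoing arc. *)
Definition color (w : nat) s : nat :=
  let p := out_port s in let i := ident (base s) in
  if p < dg s then
    let j := first_diff w i (nbr_id (base s) p) in 2 * j + bit j i
  else bit 0 i.

Definition exchange_colors (w : nat) : step :=
  Step (fun s _ => color w s) (fun s r => set_base (set_nbr_col r) s).

(** Tails have bit [beta] and heads the opposite bit, so no vertex is both a proposer and a
    recipient. *)
Definition choose_mate (w j : nat) (beta : bool) : step :=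
  Step (fun s _ => unmatched s : nat) (fun s r =>
    let p := out_port s in
    if [&& unmatched s, p < dg s, r p == 1, bit j (color w s) == beta
         & bit j (nbr_col (base s) p) == ~~ beta]
    then set_base (set_mate (Some p)) s else s).

Definition accept_mate : step :=
  Step (fun s p => (mate (base s) == Some p) : nat) (fun s r =>
    let p := find (fun p => r p == 1) (iota 0 (dg s)) in
    if unmatched s && (p < dg s) then set_base (set_mate (Some p)) s else s).

(** A silent neighbour counts like a matched one. The values are erased because a halted node no
    longer takes part in updates. *)
Definition finish : step :=
  Step (fun s _ => unmatched s : nat) (fun s r =>
    if ~~ unmatched s || all (fun p => r p != 1) (iota 0 (dg s))
    then LocalState (set_stopped true (base s)) (fun _ => 0) (fun _ => 0) else s).

Definition match_paths (w cb : nat) : seq step :=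
  exchange_colors w ::
  flatten [seq [:: choose_mate w x.1 x.2; accept_mate]
          | x <- [seq (j, beta) | j <- iota 0 cb, beta <- [:: false; true]]].

Definition rounding (K i : nat) : seq step :=
  label_class (2 ^ i) (2 * K) ::
  flatten [seq [:: split_class (2 ^ i) (2 * K) K i b; send_values] | b <- iota 0 (2 * K)].

(** After [l.+1] doublings [2 ^ l.+1] exceeds the bound [2 ^ l], as [fractional_total] needs; after
    [l + 3] roundings the common value is eight times this bound, as [pot_start] needs. *)
Definition thin_steps (l : nat) : seq step :=
  [:: activate l predT predT; send_values] ++
  flatten (nseq l.+1 [:: grow (2 ^ l); send_values]) ++
  flatten [seq rounding (l + 3) i | i <- iota 0 (l + 3)] ++ [:: isolate].

Definition thinning (w cb l : nat) : seq step := thin_steps l ++ match_paths w cb.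

Definition port_by_port (w cb l : nat) : seq step :=
  flatten [seq activate l (pred1 x.1) (pred1 x.2) :: match_paths w cb
          | x <- [seq (i, j) | i <- iota 0 (2 ^ l), j <- iota 0 (2 ^ l)]].

Definition phase (n w cb l : nat) : seq step :=
  (if 4 ^ l * cb <= lg n then port_by_port w cb l
   else flatten (nseq (256 * (lg n).+1) (thinning w cb l))) ++ [:: finish].

(** Identifiers have [w] bits and the colours are below [2 * w + 2]. The last guess suffices because
    the maximum degree is at most [n]. *)
Definition schedule (c n : nat) : seq step :=
  let w := c * lg n in let cb := up_log 2 (2 * w + 2) in
  exchange_ids :: flatten [seq phase n w cb (2 ^ k) | k <- iota 0 (up_log 2 (lg n)).+1].

Definition program (b : nat) (sched : seq step) : node_program b :=
  NodeProgram (state := seq step * local_state)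
    (fun d i => (sched, initial_state d i))
    (fun (s : seq step * local_state) p => if s.1 is a :: _ then encoded b (emit a s.2 p) else [bseq])
    (fun (s : seq step * local_state) m => if s.1 is a :: l
       then (l, absorb a s.2 (fun i => decode (nth [bseq] m i))) else s)
    (fun (s : seq step * local_state) => if stopped (base s.2) then Some (fun i => mate (base s.2) == Some i)
              else None).

(** * Executions of step lists and of the program *)

Section Semantics.
Variables (V : finType) (id : V -> nat) (port : V -> seq V) (b : nat).
Implicit Types (S : V -> local_state) (a : step).

Definition halt S v := stopped (base (S v)).

Definition inbox a S v : seq (b.-bseq bool) :=
  [seq if halt S u then [bseq] else encoded b (emit a (S u) (index v (port u)))
  | u <- port v].

Definition global_step S a : V -> local_state := fun v =>
  if halt S v then S v
  else absorb a (S v) (fun i => decode (nth [bseq] (inbox a S v) i)).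

Definition exec (l : seq step) S : V -> local_state := foldl global_step S l.

Definition start v := initial_state (size (port v)) (id v).

Lemma exec_cat l1 l2 S : exec (l1 ++ l2) S = exec l2 (exec l1 S).
Proof. exact: foldl_cat. Qed.

(** The remaining schedule is determined only at running nodes: a halted node keeps the list with
    which it stopped. *)
Lemma run_exec sched t : t <= size sched -> forall v,
  let s := run id port (program b sched) t v in
  s.2 = exec (take t sched) start v /\ (~~ halt (exec (take t sched) start) v ->
    s.1 = drop t sched).
Proof.
elim: t => [|t IH] tS v; first by rewrite take0 drop0.
have {}IH := IH (ltnW tS).
have -> : run id port (program b sched) t.+1 v =
  round port (run id port (program b sched) t) v by [].
rewrite (take_nth exchange_ids tS) -cats1 exec_cat [exec [:: _] _]/= /round /halted.
set S := exec _ _ in IH *; set s := run _ _ _ _ in IH *.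
have haltE u : isSome (output (s u)) = halt S u.
  by rewrite /= /halt -(IH u).1; case: (stopped _).
rewrite haltE /global_step; case hv: (halt S v).
  by split; [exact: (IH v).1 | rewrite {1}/halt /= hv -/(halt S v) hv].
have [s2 s1] := IH v; rewrite hv in s1; have {}s1 := s1 isT.
rewrite /= s1 (drop_nth exchange_ids tS) /= s2; split=> //; congr (absorb _ _ _).
rewrite /inbox; congr (fun m => _); set m1 := map _ _; set m2 := map _ _.
suff -> : m1 = m2 by [].
apply: eq_map => u; rewrite /message /halted haltE; case hu: (halt S u) => //=.
have [u2 u1] := IH u; rewrite hu in u1.
by rewrite u1 // (drop_nth exchange_ids tS) u2.
Qed.

End Semantics.

(** * Ports, messages and the invariants of the network state *)

Section Network.
Variables (V : finType) (e : rel V) (id : V -> nat) (port : V -> seq V) (b : nat).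
Hypotheses (e_sym : symmetric e) (e_irr : irreflexive e).
Hypotheses (id_inj : injective id) (port_ok : valid_ports e port).
Implicit Types (S : V -> local_state) (a : step) (u v w : V).

Definition pt u v := index v (port u).
Definition received a S v i := decode (nth [bseq] (inbox port b a S v) i).
Notation "S |> a" := (global_step port b S a) (at level 50, left associativity).

Lemma mem_port u v : (v \in port u) = e u v.
Proof. by have [_ ->] := port_ok u. Qed.

Lemma pt_lt u v : (pt u v < size (port u)) = e u v.
Proof. by rewrite /pt index_mem mem_port. Qed.

Lemma pt_inj u v w : e u v -> pt u v = pt u w -> v = w.
Proof.
move=> uv vw; have vp : v \in port u by rewrite mem_port.
have wp : w \in port u by rewrite mem_port -pt_lt -vw pt_lt.
by rewrite -(nth_index v vp) -(nth_index v wp) /= -/(pt u v) vw.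
Qed.

Lemma portP u p : p < size (port u) -> exists2 v, e u v & pt u v = p.
Proof.
move=> pu; exists (nth u (port u) p); first by rewrite -mem_port mem_nth.
by rewrite /pt index_uniq //; have [] := port_ok u.
Qed.

Lemma sum_port (R : Type) (idx : R) (op : Monoid.com_law idx) u (F : nat -> R) :
  \big[op/idx]_(0 <= p < size (port u)) F p = \big[op/idx]_(v | e u v) F (pt u v).
Proof.
have [pu pe] := port_ok u.
rewrite [RHS](eq_bigl (fun v => v \in port u)) => [|v]; last by rewrite mem_port.
rewrite -(big_uniq _ pu) /= (big_nth u) big_nat [RHS]big_nat; apply: eq_bigr => p /= pp.
by rewrite /pt index_uniq.
Qed.

Lemma all_ports u (P : pred nat) : all P (iota 0 (size (port u))) = [forall v, e u v ==> P (pt u v)].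
Proof.
apply/allP/forallP => [H v|H p].
  by apply/implyP => uv; apply: H; rewrite mem_iota pt_lt.
by rewrite mem_iota /= => /portP[v uv <-]; exact: (implyP (H v)).
Qed.

Lemma find_port u v (P : pred nat) : e u v -> P (pt u v) ->
  (forall w, e u w -> P (pt u w) -> w = v) ->
  find P (iota 0 (size (port u))) = pt u v.
Proof.
move=> uv Pv uniq_v; have hasP : has P (iota 0 (size (port u))).
  by apply/hasP; exists (pt u v); rewrite // mem_iota pt_lt.
have := nth_find 0 hasP; rewrite has_find size_iota in hasP.
rewrite nth_iota // add0n; case: (portP hasP) => w uw <- Pw.
by rewrite (uniq_v w).
Qed.

Lemma find_no_port u (P : pred nat) : (forall w, e u w -> ~~ P (pt u w)) ->
  find P (iota 0 (size (port u))) = size (port u).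
Proof.
move=> noP; rewrite hasNfind ?size_iota //; apply/hasPn => p.
by rewrite mem_iota => /= /portP[w uw <-]; exact: noP.
Qed.

Lemma receivedE a S v u : e v u -> emit a (S u) (pt u v) < 2 ^ b ->
  received a S v (pt v u) = if halt S u then 0 else emit a (S u) (pt u v).
Proof.
move=> vu fits; rewrite /received /inbox (nth_map u) ?pt_lt // /pt nth_index ?mem_port //.
by case: ifP => // _; rewrite encodeK.
Qed.

Lemma step_on a S v : ~~ halt S v -> (S |> a) v = absorb a (S v) (received a S v).
Proof. by rewrite /global_step => /negbTE ->. Qed.

Lemma step_off a S v : halt S v -> (S |> a) v = S v.
Proof. by rewrite /global_step => ->. Qed.

Definition mates S u v := e u v && (mate (base (S u)) == Some (pt u v)).

(** [inv_halt] certifies that the edges at a halted node are covered; [inv_zero] lets such a node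
    count as one without arcs, although its memory is frozen. *)
Record consistent S : Prop := Inv {
  inv_deg : forall v, dg (S v) = size (port v);
  inv_id : forall v, ident (base (S v)) = id v;
  inv_nbr : forall u v, e u v -> nbr_id (base (S u)) (pt u v) = id v;
  inv_mate : forall u p, mate (base (S u)) = Some p -> p < size (port u);
  inv_sym : forall u v, mates S u v -> mates S v u;
  inv_halt : forall v, halt S v -> ~~ unmatched (S v) \/ forall u, e v u -> ~~ unmatched (S u);
  inv_zero : forall v p, halt S v -> xout (S v) p = 0 /\ xin (S v) p = 0 }.

(** The neighbours' colours and the class labels are left out: they are scratch fields, rewritten
    within an iteration. *)
Definition core (z : node) := (deg z, ident z, nbr_id z, mate z, stopped z).

Definition keeps S S' :=
  (forall v, core (base (S' v)) = core (base (S v))) /\ (forall v, halt S v -> S' v = S v).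

Lemma keeps_halt S S' : keeps S S' -> forall v, halt S' v = halt S v.
Proof. by case=> K _ v; rewrite /halt; case: (K v). Qed.

Lemma keeps_deg S S' : keeps S S' -> forall v, dg (S' v) = dg (S v).
Proof. by case=> K _ v; rewrite /dg; case: (K v). Qed.

Lemma keeps_ident S S' : keeps S S' -> forall v, ident (base (S' v)) = ident (base (S v)).
Proof. by case=> K _ v; case: (K v). Qed.

Lemma keeps_nbr S S' : keeps S S' -> forall v, nbr_id (base (S' v)) = nbr_id (base (S v)).
Proof. by case=> K _ v; case: (K v). Qed.

Lemma keeps_mate S S' : keeps S S' -> forall v, mate (base (S' v)) = mate (base (S v)).
Proof. by case=> K _ v; case: (K v). Qed.

Lemma keeps_unmatched S S' : keeps S S' -> forall v, unmatched (S' v) = unmatched (S v).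
Proof. by move=> K v; rewrite /unmatched (keeps_mate K). Qed.

Lemma keeps_trans S1 S2 S3 : keeps S1 S2 -> keeps S2 S3 -> keeps S1 S3.
Proof.
move=> K1 K2; case: (K1) (K2) => C1 H1 [C2 H2]; split=> v; first by rewrite C2.
by move=> h; rewrite H2 ?(keeps_halt K1) // H1.
Qed.

Lemma inv_keeps S S' : keeps S S' -> consistent S -> consistent S'.
Proof.
move=> K I; have [C H] := K; have m := keeps_mate K.
split=> [v|v|u v uv|u p|u v|v|v p].
- by rewrite (keeps_deg K) (inv_deg I).
- by rewrite (keeps_ident K) (inv_id I).
- by rewrite (keeps_nbr K) (inv_nbr I).
- by rewrite m; exact: inv_mate I u p.
- by rewrite /mates !m; exact: inv_sym I u v.
- rewrite (keeps_halt K) !(keeps_unmatched K) => /(inv_halt I)[|h]; [by left|right=> u].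
  by rewrite (keeps_unmatched K); exact: h.
- by rewrite (keeps_halt K) => h; rewrite H //; exact: inv_zero I v p h.
Qed.

Lemma keeps_step S a : (forall v r, core (base (absorb a (S v) r)) = core (base (S v))) ->
  keeps S (S |> a).
Proof.
move=> H; split=> v; last by move/step_off.
by case h: (halt S v); [rewrite step_off | rewrite step_on ?h].
Qed.

Definition arcs S u v := if e u v then xout (S u) (pt u v) else 0.
Definition synced S := forall u v, e u v -> xin (S v) (pt v u) = arcs S u v.
Definition active l S u v := [&& e u v, light l (S u), light l (S v) & id u < id v].

Lemma sum_out S u : consistent S -> sum_ports (S u) (xout (S u)) = outs (arcs S) u.
Proof.
move=> I; rewrite /sum_ports (inv_deg I) sum_port /outs [RHS](bigID (e u)) /=.
rewrite [X in _ = _ + X]big1 ?addn0 => [|v /negbTE uv]; last by rewrite /arcs uv.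
by apply: eq_bigr => v uv; rewrite /arcs uv.
Qed.

Lemma sum_in S v : consistent S -> synced S -> sum_ports (S v) (xin (S v)) = ins (arcs S) v.
Proof.
move=> I Y; rewrite /sum_ports (inv_deg I) sum_port /ins [RHS](bigID (e v)) /=.
rewrite [X in _ = _ + X]big1 ?addn0 => [|u]; last first.
  by rewrite e_sym => /negbTE vu; rewrite /arcs vu.
by apply: eq_bigr => u uv; rewrite Y // e_sym.
Qed.

Lemma count_out S u : consistent S -> count_ports (S u) (xout (S u)) = outdeg (arcs S) u.
Proof.
move=> I; rewrite /count_ports (inv_deg I) (sum_port _ u (fun p => nat_of_bool (xout (S u) p != 0))).
rewrite big_mkcond /outdeg -sum1_card [RHS]big_mkcond /=; apply: eq_bigr => v _.
by rewrite inE /arcs; case: ifP => // _; case: (_ == _).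
Qed.

Lemma count_in S v : consistent S -> synced S -> count_ports (S v) (xin (S v)) = indeg (arcs S) v.
Proof.
move=> I Y; rewrite /count_ports (inv_deg I) (sum_port _ v (fun p => nat_of_bool (xin (S v) p != 0))).
rewrite big_mkcond /indeg -sum1_card [RHS]big_mkcond /=; apply: eq_bigr => u _.
rewrite inE; case: ifP => vu; first by rewrite Y 1?e_sym //; case: (_ == _).
by rewrite /arcs e_sym vu.
Qed.

(** A halted node is matched or has only matched neighbours, which excludes an edge with two
    unmatched ends. *)
Lemma active_on l S u v : consistent S -> active l S u v -> ~~ halt S u /\ ~~ halt S v.
Proof.
move=> I /and4P[uv /andP[fu _] /andP[fv _] _]; split; apply/negP.
  by case/(inv_halt I); rewrite ?fu // => /(_ v uv); rewrite fv.
by case/(inv_halt I); rewrite ?fv // => /(_ u); rewrite e_sym uv fu => /(_ isT).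
Qed.

Lemma active_keeps l S S' u v : keeps S S' -> active l S' u v = active l S u v.
Proof. by move=> K; rewrite /active /light !(keeps_unmatched K) !(keeps_deg K). Qed.

Lemma activateP l tp hp S : 0 < b -> consistent S ->
  let S' := S |> activate l tp hp in
  keeps S S' /\ forall u v, arcs S' u v = [&& active l S u v, tp (pt u v) & hp (pt v u)].
Proof.
move=> b0 I S'; have K : keeps S S' by apply: keeps_step.
split=> // u v; rewrite /arcs; case: ifP => uv; last by rewrite /active uv.
case hu: (halt S u).
  rewrite /S' step_off // (inv_zero I _ hu).1.
  by case auv: (active l S u v) => //; have [] := active_on I auv; rewrite hu.
rewrite /S' step_on ?hu //= (inv_deg I) pt_lt uv (inv_nbr I uv) (inv_id I).
rewrite receivedE //=; last by apply: leq_ltn_trans (leq_b1 _) _; rewrite -{1}(expn0 2) ltn_exp2l.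
rewrite /active uv /=; case lu: (light l (S u)) => //=.
case hv: (halt S v).
  rewrite andbF; case lv: (light l (S v)) => //=; case iuv: (id u < id v) => //=.
  have [] := @active_on l S u v I; last by rewrite hv.
  by rewrite /active uv lu lv.
by rewrite eqb1; case: (light l (S v)); case: (tp _); case: (hp _); case: (_ < _).
Qed.

Lemma send_valuesP S : consistent S -> (forall u v, arcs S u v < 2 ^ b) ->
  (forall u v, halt S v -> arcs S u v = 0) ->
  let S' := S |> send_values in
  [/\ forall v, base (S' v) = base (S v), forall v, halt S v -> S' v = S v,
      synced S' & forall u v, arcs S' u v = arcs S u v].
Proof.
move=> I small offz S'.
have off v : halt S v -> S' v = S v by exact: step_off.
have xE u : xout (S' u) = xout (S u).
  by case hu: (halt S u); [rewrite off | rewrite /S' step_on ?hu].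
have aE u v : arcs S' u v = arcs S u v by rewrite /arcs xE.
split=> // [v|u v uv]; first by case hv: (halt S v); [rewrite off | rewrite /S' step_on ?hv].
rewrite aE; case hv: (halt S v).
  by rewrite off // offz // (inv_zero I _ hv).2.
have small' : xout (S u) (pt u v) < 2 ^ b by have := small u v; rewrite /arcs uv.
rewrite /S' step_on ?hv //= receivedE 1?e_sym //=.
by rewrite /arcs uv; case hu: (halt S u) => //; rewrite (inv_zero I _ hu).1.
Qed.

Definition settled l S0 S := [/\ keeps S0 S, synced S
  & forall u v, ~~ active l S0 u v -> arcs S u v = 0].

(** The common frame of doubling and splitting: tails rewrite their outgoing values, then
    [send_values] refreshes the copies at the heads. *)
Lemma update_outP l S0 S em f : consistent S0 -> settled l S0 S ->
  (forall v p, em (S v) p < 2 ^ b) ->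
  let a := update_out em f in
  (forall u v, active l S0 u v -> f (S u) (received a S u) (pt u v) < 2 ^ b) ->
  (forall u v, e u v -> arcs S u v = 0 -> ~~ halt S u ->
     f (S u) (received a S u) (pt u v) = 0) ->
  let S' := S |> a |> send_values in
  [/\ settled l S0 S', forall v, base (S' v) = base (S v)
   & forall u v, active l S0 u v -> arcs S' u v = f (S u) (received a S u) (pt u v)].
Proof.
move=> I0 [K Y Z] small a fsmall fz S'; pose S1 := S |> a.
have I := inv_keeps K I0.
have base1 v : base (S1 v) = base (S v).
  by rewrite /S1; case hv: (halt S v); [rewrite step_off | rewrite step_on ?hv].
have K1 : keeps S S1.
  by split=> v; [rewrite base1 | move=> hv; rewrite /S1 step_off].
have I1 := inv_keeps K1 I.
have arcA u v : active l S0 u v -> arcs S1 u v = f (S u) (received a S u) (pt u v).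
  move=> auv; have [uv _ _ _] := and4P auv.
  have [hu _] := active_on I0 auv.
  by rewrite /arcs uv /S1 step_on // (keeps_halt K).
have arcN u v : ~~ active l S0 u v -> arcs S1 u v = 0.
  move=> nuv; have := Z u v nuv; rewrite /arcs; case: ifP => // uv arc0.
  case hu: (halt S u); first by rewrite /S1 step_off.
  by rewrite /S1 step_on ?hu //= fz ?hu // /arcs uv.
have [|u v hv|B H Y2 A2] := @send_valuesP S1 I1.
- move=> u v; case auv: (active l S0 u v); first by rewrite arcA ?fsmall.
  by rewrite arcN ?auv // expn_gt0.
- apply: arcN; apply/negP => auv; have [_] := active_on I0 auv.
  by rewrite -(keeps_halt K) -(keeps_halt K1) hv.
have K2 : keeps S1 S' by split=> v; [rewrite B | exact: H].
split=> [|v|u v auv]; last by rewrite A2 arcA.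
  split=> [||u v nuv]; [|by []|by rewrite A2 arcN].
  by apply: keeps_trans K _; apply: keeps_trans K1 K2.
by rewrite B base1.
Qed.

Lemma growP l (r : nat) S0 S : l < b -> consistent S0 -> settled l S0 S ->
  fractional_inv (active l S0) (2 ^ l) r (arcs S) ->
  let S' := S |> grow (2 ^ l) |> send_values in
  settled l S0 S' /\ fractional_inv (active l S0) (2 ^ l) r.+1 (arcs S').
Proof.
move=> lb I0 ST FI; have [K Y Z] := ST; have I := inv_keeps K I0.
set a := grow (2 ^ l).
have b0 : 0 < b by exact: leq_ltn_trans lb.
have em1 v p : emit a (S v) p < 2 ^ b.
  by apply: leq_ltn_trans (leq_b1 _) _; rewrite -{1}(expn0 2) ltn_exp2l.
have fE u v : active l S0 u v ->
   (if (2 * sum_ports (S u) (xout (S u)) <= 2 ^ l) && (received a S u (pt u v) == 1)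
       then 2 * xout (S u) (pt u v) else xout (S u) (pt u v)) = doubled (2 ^ l) (arcs S) u v.
  move=> auv; have [uv _ _ _] := and4P auv.
  have [_ hv] := active_on I0 auv.
  rewrite (receivedE uv (em1 _ _)) (keeps_halt K) (negbTE hv) /= eqb1.
  rewrite (sum_out u I) (sum_in v I Y) /doubled.
  by rewrite {5 6}/arcs uv.
have [oT _ _ _ _] := FI.
have small u v : active l S0 u v -> doubled (2 ^ l) (arcs S) u v < 2 ^ b.
  move=> auv; apply: (@leq_ltn_trans (2 ^ l)); last by rewrite ltn_exp2l.
  rewrite /doubled; have ou := outs_ge (arcs S) u v.
  case: ifP => [/andP[h _]|_]; last by exact: leq_trans ou (oT u).
  by apply: leq_trans h; rewrite leq_mul2l ou orbT.
have [|u v uv a0 hu|ST' _ A'] :=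
    update_outP I0 ST (em := emit a) (f := fun s r => xout (absorb a s r)) em1.
- by move=> u v auv /=; rewrite fE //; exact: small.
- by move: a0; rewrite /arcs uv /= => ->; case: ifP.
split=> //; apply: fractional_inv_doubled FI => u v.
case auv: (active l S0 u v); last first.
  have [_ _ Z'] := ST'; rewrite Z' ?auv // /doubled Z ?auv //.
  by case: ifP.
by rewrite A' //= fE.
Qed.

Lemma eq_tail_gain (a q : int) R (x y : V -> nat) : x =1 y -> tail_gain a q R x = tail_gain a q R y.
Proof.
move=> xy; rewrite /tail_gain (@eq_psum _ _ (fun v => (y v)%:Z%R)); last by move=> v; rewrite xy.
by congr (_ * _ - _ - _ * _)%R; apply: eq_bigr => v _; rewrite xy.
Qed.

Lemma eq_tail_gainR (a q : int) (R R' : V -> int) x :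
  R =1 R' -> tail_gain a q R x = tail_gain a q R' x.
Proof.
by move=> RR; rewrite /tail_gain; congr (_ - _ * _)%R; apply: eq_bigr => v _; rewrite RR.
Qed.

Lemma port_gainE u (a q : int) R x :
  port_gain (size (port u)) a q R x =
  tail_gain a q (fun v => if e u v then R (pt u v) else 0%R)
    (fun v => if e u v then x (pt u v) else 0).
Proof.
rewrite /port_gain /tail_gain /psum !sum_port.
congr (_ * _ - _ * (_ ^+ 2 - _) - _ * _)%R; rewrite big_mkcond; apply: eq_bigr => v _;
  by case: ifP.
Qed.

Lemma count_port_class u (P : pred nat) (Q : pred V) :
  (forall v, Q v = e u v && P (pt u v)) ->
  #|Q| = count P (iota 0 (size (port u))).
Proof.
move=> QP; transitivity (\sum_(v | e u v) nat_of_bool (P (pt u v))).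
  rewrite -sum1_card big_mkcond [RHS]big_mkcond; apply: eq_bigr => v _.
  by rewrite [v \in Q]QP; case: (e u v) => //=; case: (P _).
rewrite -(sum_port _ u (fun p => nat_of_bool (P p))) /index_iota subn0.
by rewrite -sum1_count [RHS]big_mkcond; apply: eq_bigr => p _; case: (P p).
Qed.

Lemma exec_iota (f : nat -> seq step) m S :
  exec port b (flatten [seq f j | j <- iota 0 m.+1]) S =
  exec port b (f m) (exec port b (flatten [seq f j | j <- iota 0 m]) S).
Proof. by rewrite -[m.+1]addn1 iotaD map_cat flatten_cat exec_cat /= cats0. Qed.

Lemma exec_nseq (f : seq step) m S :
  exec port b (flatten (nseq m.+1 f)) S = exec port b f (exec port b (flatten (nseq m f)) S).
Proof.
by rewrite -exec_cat; congr exec; elim: m => [|m IH] /=; rewrite ?cats0 // -catA -IH.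
Qed.

Definition powers_between i K (X : V -> V -> nat) :=
  forall u v, X u v = 0 \/ exists2 j, i <= j <= K & X u v = 2 ^ j.

(** * One rounding step, class by class *)

Section RoundingStep.
Variables (l i : nat) (S0 S : V -> local_state).
Let K := l + 3.
Let L := 2 * K.
Let h := 2 ^ i.
Hypotheses (I0 : consistent S0) (ST : settled l S0 S) (iK : i < K).
Hypothesis bK : #|V|.+1 * 2 ^ K < 2 ^ b.
Hypothesis powX : powers_between i K (arcs S).

Let a : int := Posz (L ^ (K - i.+1) * 2 ^ K).
Let q : nat := L.+1 ^ (K - i.+1).
Let S1 := S |> label_class h L.
Let A := active l S0.
Let X := arcs S.
(** The default [L] on inactive pairs makes [lab v u < L] characterise the arcs of value [h]. *)
Let lab v u := if A u v then label (base (S1 v)) (pt v u) else L.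

Lemma labelled_settled : settled l S0 S1 /\ (forall u v, arcs S1 u v = X u v).
Proof.
have [K0 Y Z] := ST.
have xE v : xout (S1 v) = xout (S v) /\ xin (S1 v) = xin (S v).
  by rewrite /S1; case hv: (halt S v); [rewrite step_off | rewrite step_on ?hv].
have aE u v : arcs S1 u v = X u v by rewrite /arcs (xE u).1.
split=> //; split=> [|u v uv|u v nuv].
- by apply: keeps_trans K0 _; apply: keeps_step.
- by rewrite (xE v).2 aE; exact: Y.
- by rewrite aE; exact: Z.
Qed.

Lemma h_gt0 : 0 < h. Proof. by rewrite expn_gt0. Qed.
Lemma L_gt0 : 0 < L. Proof. by rewrite /L /K; lia. Qed.

Lemma arc_active u v : X u v = h -> A u v.
Proof.
move=> Xh; case auv: (A u v) => //; have [_ _ Z] := ST.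
by have := h_gt0; rewrite -Xh /X Z // -/A auv.
Qed.

Lemma label_on u v : e u v -> ~~ halt S v -> label (base (S1 v)) (pt v u) =
  if X u v == h then count (fun p => xin (S v) p == h) (iota 0 (pt v u)) %% L else L.
Proof.
move=> uv hv; have [K0 Y Z] := ST; have I := inv_keeps K0 I0.
by rewrite /S1 step_on //= (inv_deg I) pt_lt e_sym uv /= Y.
Qed.

Lemma active_halt u v : A u v -> ~~ halt S u /\ ~~ halt S v.
Proof. by have [K0 _ _] := ST; rewrite !(keeps_halt K0); exact: active_on I0. Qed.

Lemma lab_lt u v : (lab v u < L) = (X u v == h).
Proof.
rewrite /lab; case auv: (A u v); last first.
  by rewrite ltnn; apply/esym/negP => /eqP/arc_active; rewrite auv.
have [uv _ _ _] := and4P auv; rewrite label_on ?(active_halt auv).2 //.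
by case: ifP; rewrite ?ltnn ?ltn_mod ?L_gt0.
Qed.

(** At a running head the classes are the modular classes of its ports of value [h]; a halted head
    has no active arc and hence empty classes. *)
Lemma lab_balanced v c : c < L ->
  L * #|[pred u | lab v u == c]|.-1 <= #|[set u | X u v == h]|.-1.
Proof.
move=> cL; case hv: (halt S v).
  rewrite (_ : #|_| = 0) ?muln0 //; apply: eq_card0 => u; rewrite !inE.
  rewrite /lab; case: ifP => [auv|_]; last by apply/negbTE; rewrite neq_ltn cL orbT.
  by have := (active_halt auv).2; rewrite hv.
have [K0 Y Z] := ST.
have xh u : e v u -> (xin (S v) (pt v u) == h) = (X u v == h) by move=> vu; rewrite Y 1?e_sym.
rewrite (@count_port_class v (fun p => (xin (S v) p == h) &&
   (count (fun p => xin (S v) p == h) (iota 0 p) %% L == c)) [pred u | lab v u == c]); last first.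
  move=> u /=; case vu: (e v u) => /=; last first.
    by rewrite /lab /A /active e_sym vu /=; apply/negbTE; rewrite neq_ltn cL orbT.
  rewrite xh //; case Xh: (X u v == h) => /=; last first.
    by apply/negP => /eqP lc; have := lab_lt u v; rewrite lc cL Xh.
  by rewrite /lab (arc_active (eqP Xh)) label_on ?hv 1?e_sym // Xh.
rewrite cardsE (@count_port_class v (fun p => xin (S v) p == h) (fun u => X u v == h)); last first.
  move=> u; case vu: (e v u); first by rewrite xh.
  by apply/negbTE/negP => /eqP/arc_active; rewrite /A /active e_sym vu.
exact: (modular_class_balanced (fun p => xin (S v) p == h)).
Qed.

Let loss c := \sum_v #|[pred u | lab v u == c]| * #|[pred u | lab v u == c]|.-1.

Definition partly_split c S' := [/\ settled l S0 S', forall v, base (S' v) = base (S1 v),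
  forall u v, lab v u < c -> arcs S' u v = 0 \/ arcs S' u v = h.*2,
  forall u v, c <= lab v u -> arcs S' u v = X u v
  & (potential a q X <= potential a q (arcs S') +
      q%:Z * (h%:Z ^+ 2 * (\sum_(c' < c) loss c')%N%:Z))%R].

(** The arcs of class [c] still have value [h]. Each tail learns the current in-sums of their heads
    and decides greedily, and [potential_class_step] bounds the combined effect. *)
Lemma split_classP c S' : c < L -> partly_split c S' ->
  partly_split c.+1 (S' |> split_class h L K i c |> send_values).
Proof.
move=> cL [ST' B lo hi pot]; have [K' Y' Z'] := ST'; have I' := inv_keeps K' I0.
have h2K : h.*2 <= 2 ^ K by rewrite /h -mul2n -expnS leq_exp2l.
have K2b : 2 ^ K < 2 ^ b by apply: leq_ltn_trans _ bK; rewrite leq_pmull.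
have hL u v : lab v u = c -> X u v = h by move=> lc; apply/eqP; rewrite -lab_lt lc.
have hS u v : lab v u = c -> arcs S' u v = h.
  by move=> lc; rewrite hi ?lc // hL.
have leK u v : arcs S' u v <= 2 ^ K.
  case: (ltnP (lab v u) c) => [/lo [] ->|/hi ->] //.
  by rewrite /X; case: (powX u v) => [->|[j /andP[_ jK] ->]] //; rewrite leq_exp2l.
set st := split_class h L K i c.
(* The largest message is an in-sum plus one; [bK] is the room needed for it. *)
have em1 v p : emit st (S' v) p < 2 ^ b.
  apply: leq_ltn_trans _ bK; rewrite /= (sum_in _ I' Y').
  have : ins (arcs S') v <= #|V| * 2 ^ K.
    by rewrite -sum_nat_const; apply: leq_sum => u _; exact: leK.
  have : 0 < 2 ^ K by rewrite expn_gt0.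
  by rewrite mulSn => z0 le; case: ifP => // _; rewrite -add1n leq_add.
pose R u v := (if lab v u == c then ins (arcs S') v - h else 0).
have rcv u v : e u v -> ~~ halt S' u ->
    let r := received st S' u (pt u v) in
    (r != 0) = (lab v u == c) /\ (if r != 0 then r.-1 - h else 0) = R u v.
  move=> uv hu /=; rewrite /R (receivedE uv (em1 _ _)) /= B (sum_in _ I' Y').
  case hv: (halt S' v).
    have -> : (lab v u == c) = false; last by rewrite eqxx.
    apply/negP => /eqP lc; have := hL _ _ lc => /arc_active/(active_on I0)[_].
    by rewrite -(keeps_halt K') hv.
  have [K0 _ _] := ST.
  have -> : (lab v u == c) = (label (base (S1 v)) (pt v u) == c).
    rewrite /lab; case: ifP => // nauv; rewrite label_on ?(keeps_halt K0) -?(keeps_halt K') ?hv //.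
    by case: ifP => // /eqP/arc_active; rewrite nauv.
  by case: ifP.
have spec u : ~~ halt S' u -> let y := xout (absorb st (S' u) (received st S' u)) in
   [/\ forall v, e u v -> lab v u != c -> y (pt u v) = xout (S' u) (pt u v),
       forall v, e u v -> lab v u == c -> y (pt u v) = 0 \/ y (pt u v) = h.*2
     & (tail_gain a q (fun v => (R u v)%:Z) (arcs S' u) <=
        tail_gain a q (fun v => (R u v)%:Z) (fun v => if e u v then y (pt u v) else 0%N))%R].
  move=> hu y.
  have := @greedyP (dg (S' u)) a q h (fun p => Posz (if received st S' u p != 0 then
    (received st S' u p).-1 - h else 0)) (fun p => received st S' u p != 0) (xout (S' u)).
  rewrite (inv_deg I') => -[p|G1 G2 G3].
    case/portP=> v uv <-; have [-> _] := rcv u v uv hu => /eqP lc.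
    by have := hS _ _ lc; rewrite /arcs uv.
  have yE : y = greedy (size (port u)) a q h (fun p => Posz (if received st S' u p != 0 then
    (received st S' u p).-1 - h else 0)) (fun p => received st S' u p != 0) (xout (S' u)).
    by rewrite /y /= (inv_deg I').
  split=> [v uv lc|v uv lc|]; rewrite ?yE.
  - by apply: G2; have [-> _] := rcv u v uv hu; rewrite (negbTE lc) andbF.
  - by apply: G3; [rewrite pt_lt | have [-> _] := rcv u v uv hu].
  - move: G1; rewrite !port_gainE; set R' := fun v => _.
    have RR : forall v, R' v = (R u v)%:Z%R.
      move=> v; rewrite /R' /R; case uv: (e u v); first by have [_ ->] := rcv u v uv hu.
      by case: eqP => // lc; have := arc_active (hL _ _ lc); rewrite /A /active uv.
    by rewrite !(eq_tail_gainR _ _ _ RR).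
have X'z u v : e u v -> arcs S' u v = 0 -> ~~ halt S' u ->
    xout (absorb st (S' u) (received st S' u)) (pt u v) = 0.
  move=> uv a0 hu; have [s1 _ _] := spec u hu; rewrite s1 //; first by move: a0; rewrite /arcs uv.
  by apply: contraTneq h_gt0 => /hS; rewrite a0 => <-.
have [|ST'' B'' A''] := update_outP I0 ST' (em := emit st)
   (f := fun s r => xout (absorb st s r)) em1 _ X'z.
  move=> u v auv; have [uv _ _ _] := and4P auv.
  have [hu _] := active_on I0 auv; rewrite -(keeps_halt K') in hu.
  have [s1 s2 _] := spec u hu; apply: leq_ltn_trans _ K2b.
  case lc: (lab v u == c); first by case: (s2 v uv lc) => ->.
  by rewrite s1 ?lc //; have := leK u v; rewrite /arcs uv.
set S'' := S' |> _ |> _ in ST'' B'' A'' *.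
have arcN u v : lab v u != c -> arcs S'' u v = arcs S' u v.
  move=> lc; case auv: (A u v); last by case: ST'' => _ _ Z''; rewrite Z'' ?Z' -/A ?auv.
  have [uv _ _ _] := and4P auv.
  have [hu _] := active_on I0 auv; rewrite -(keeps_halt K') in hu.
  by have [s1 _ _] := spec u hu; rewrite A'' // s1 // /arcs uv.
have arcC u v : lab v u = c -> arcs S'' u v = 0 \/ arcs S'' u v = h.*2.
  move=> lc; have auv := arc_active (hL _ _ lc); have [uv _ _ _] := and4P auv.
  have [hu _] := active_on I0 auv; rewrite -(keeps_halt K') in hu.
  by have [_ s2 _] := spec u hu; rewrite A'' //; apply: s2; rewrite ?lc.
split=> // [v|u v|u v cl|]; first by rewrite B''.
- rewrite ltnS leq_eqVlt => /orP[/eqP/arcC //|lc]; rewrite arcN ?ltn_eqF //; exact: lo.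
- by rewrite arcN ?gtn_eqF // hi // ltnW.
rewrite big_ord_recr /= PoszD !GRing.mulrDr GRing.addrA.
have step_gain : (potential a q (arcs S') <= potential a q (arcs S'') +
    q%:Z * h%:Z ^+ 2 * (loss c)%:Z)%R.
  apply: potential_class_step => [u v /arcN //|u v /eqP /hS //|u v /eqP /arcC //|u] /=.
  have RE v : (if lab v u == c then (ins (arcs S') v - h)%N%:Z else 0)%R = (R u v)%:Z%R.
    by rewrite /R; case: ifP.
  (* A halted tail has no arc in the class, so its values stay as they are. *)
  rewrite !(eq_tail_gainR _ _ _ RE); case hu: (halt S' u).
    rewrite [leRHS](@eq_tail_gain _ _ _ _ (arcs S' u)) // => v; apply: arcN.
    apply/eqP => lc; have [] := active_on I0 (arc_active (hL _ _ lc)).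
    by rewrite -(keeps_halt K') hu.
  have [_ _ g] := spec u (negbT hu); apply: Order.POrderTheory.le_trans g _.
  rewrite Order.POrderTheory.le_eqVlt; apply/orP; left; apply/eqP; apply: eq_tail_gain => v.
  case uv: (e u v); last by rewrite /arcs uv.
  case auv: (A u v); first by rewrite A''.
  have nauv : ~~ active l S0 u v by rewrite -/A auv.
  by have [_ _ Z''] := ST''; rewrite Z'' // X'z ?hu // Z'.
by apply: Order.POrderTheory.le_trans pot _; rewrite -GRing.mulrA in step_gain; lra.
Qed.

(** Over all [L] classes the loss is at most a [1 / L] fraction of the incoming conflicts, by
    [class_loss_le]; the change of weights in [pot] absorbs it. *)
Lemma roundingP : let S' := exec port b (rounding K i) S in
  [/\ settled l S0 S', powers_between i.+1 K (arcs S')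
    & (pot L K i (arcs S) <= L%:Z * pot L K i.+1 (arcs S'))%R].
Proof.
have [ST1 X1] := labelled_settled.
set f := fun c => [:: split_class h L K i c; send_values].
have loop c : c <= L -> partly_split c (exec port b (flatten [seq f j | j <- iota 0 c]) S1).
  elim: c => [|c IH] cL; last by rewrite exec_iota; apply: split_classP (IH (ltnW cL)).
  split=> //.
  have {1}<- : potential a q (arcs S1) = potential a q X.
    rewrite /potential /volume /outs /pout /pin.
    congr (_ * _ - _ * (_ + _))%R; first by congr Posz; do 2 apply: eq_bigr => ? _; rewrite X1.
      by apply: eq_bigr => u _; apply: eq_psum => v; rewrite X1.
    by apply: eq_bigr => u _; apply: eq_psum => v; rewrite X1.
  by rewrite big_ord0 !GRing.mulr0 GRing.addr0.
have [ST' _ lo hi gain] := loop L (leqnn L).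
split=> //; last first.
  by apply: pot_step gain _ => //; exact: class_loss_le lab_lt lab_balanced.
(* An arc of value [h] has become 0 or [2h]; every other nonzero value was already a larger power of
   two. *)
move=> u v; have := lab_lt u v; case: (ltnP (lab v u) L) => [lc _|lc /esym/negbT Xh].
  case: (lo u v lc) => ->; [by left | right].
  by exists i.+1; rewrite ?iK ?leqnn // /h -mul2n -expnS.
rewrite hi // /X; case: (powX u v) => [|[j /andP[ij jK] Xj]]; [by left | right].
exists j => //; rewrite jK andbT ltn_neqAle ij andbT.
by apply: contraNneq Xh => ij'; rewrite /X Xj /h ij'.
Qed.

End RoundingStep.

(** * From activation to conflict-free arcs *)

Lemma isolateP l S0 S : 0 < b -> consistent S0 -> settled l S0 S ->
  keeps S0 (S |> isolate) /\
  forall u v, arcs (S |> isolate) u v = unique_arc (arcs S) u v.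
Proof.
move=> b0 I0 [K Y Z]; have I := inv_keeps K I0.
split=> [|u v]; first by apply: keeps_trans K _; apply: keeps_step.
rewrite {1}/arcs /unique_arc; case: ifP => uv; last by rewrite {1}/arcs uv.
have arcE : arcs S u v = xout (S u) (pt u v) by rewrite /arcs uv.
case hu: (halt S u).
  by rewrite step_off // arcE (inv_zero I _ hu).1.
rewrite step_on ?hu //= receivedE //=; last first.
  by apply: leq_ltn_trans (leq_b1 _) _; rewrite -{1}(expn0 2) ltn_exp2l.
rewrite (count_out _ I) (count_in _ I Y) -arcE.
case: (arcs S u v =P 0) => //= /eqP a0.
have auv : active l S0 u v by apply: contraNT a0 => /Z ->.
have [_ hv] := active_on I0 auv; rewrite (keeps_halt K) (negbTE hv).
by rewrite eqb1.
Qed.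

Lemma activate_fractional l S : l < b -> consistent S ->
  let S' := exec port b [:: activate l predT predT; send_values] S in
  settled l S S' /\ fractional_inv (active l S) (2 ^ l) 0 (arcs S').
Proof.
move=> lb I; have b0 : 0 < b by exact: leq_ltn_trans lb.
have [K1 A1] := activateP l predT predT b0 I.
set S1 := S |> _ in K1 A1 *.
have A1' u v : arcs S1 u v = active l S u v by rewrite A1 /= !andbT.
have I1 := inv_keeps K1 I.
have [u v|u v hv|B H Y2 A2] := @send_valuesP S1 I1.
- by rewrite A1'; apply: leq_ltn_trans (leq_b1 _) _; rewrite -{1}(expn0 2) ltn_exp2l.
- rewrite A1'; case auv: (active l S u v) => //.
  by have [_] := active_on I auv; rewrite -(keeps_halt K1) hv.
move=> S'; rewrite -/S' in A2 Y2.
have A u v : arcs S' u v = active l S u v by rewrite A2.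
have sizeE u : size (port u) = \sum_(v | e u v) 1.
  by rewrite -(sum_port _ u (fun=> 1)) sum_nat_const_nat subn0 muln1.
split; first split=> //.
- by apply: keeps_trans K1 _; split=> v; [rewrite B | exact: H].
- by move=> u v /negbTE; rewrite A => ->.
split=> [u|v|u v auv|u v /negbTE|u v auv]; rewrite ?A ?auv //.
- rewrite /outs (eq_bigr (fun v => nat_of_bool (active l S u v))) => [|v _]; last exact: A.
  case lu: (light l (S u)); last by rewrite big1 // => v _; rewrite /active lu andbF.
  have /andP[_ du] := lu; apply: leq_trans du; rewrite (inv_deg I) sizeE [leqRHS]big_mkcond.
  by apply: leq_sum => v _; rewrite /active; case: (e u v) => //=; rewrite leq_b1.
- rewrite /ins (eq_bigr (fun u => nat_of_bool (active l S u v))) => [|u _]; last exact: A.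
  case lv: (light l (S v)); last by rewrite big1 // => u _; rewrite /active lv !andbF.
  have /andP[_ dv] := lv; apply: leq_trans dv; rewrite (inv_deg I) sizeE [leqRHS]big_mkcond.
  by apply: leq_sum => u _; rewrite /active e_sym; case: (e v u) => //=; rewrite leq_b1.
- by exists 0.
- by move->.
Qed.

(** With [T = 2 ^ l] and [U] conflict-free arcs, [T * nu] is at most [4 * volume], and the potential
    argument gives that [4 * T * volume] is at most [(8 * T) ^ 2 * U]; together this is the factor
    64. *)
Lemma thin_stepsP l S0 : consistent S0 -> #|V|.+1 * 2 ^ (l + 3) < 2 ^ b ->
  let S' := exec port b (thin_steps l) S0 in
  [/\ keeps S0 S', forall u v, arcs S' u v != 0 -> active l S0 u v,
      forall u, outdeg (arcs S') u <= 1, forall v, indeg (arcs S') v <= 1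
    & nu (active l S0) <= 64 * #|[set x : V * V | arcs S' x.1 x.2 != 0]|].
Proof.
move=> I0 bK; set K := l + 3; set L := 2 * K; set T := 2 ^ l.
have L0 : 0 < L by rewrite /L /K; lia.
have lb : l < b.
  rewrite -(ltn_exp2l _ _ (isT : 1 < 2)); apply: leq_ltn_trans bK.
  by apply: (@leq_trans (2 ^ (l + 3))); rewrite ?leq_exp2l ?leq_addr // leq_pmull.
have KT : 2 ^ K = 8 * T by rewrite /K expnD mulnC.
rewrite /thin_steps; set g := flatten (nseq _ _); set rr := flatten (map _ _).
rewrite exec_cat [exec _ _ (g ++ _) _]exec_cat [exec _ _ (rr ++ _) _]exec_cat /g /rr {g rr}.
have [] := activate_fractional lb I0; set Sa := exec _ _ _ S0 => STa Fa.
set Sg := exec port b (flatten (nseq l.+1 _)) Sa.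
have [STg Fg] : settled l S0 Sg /\ fractional_inv (active l S0) T l.+1 (arcs Sg).
  rewrite /Sg; elim: (l.+1) => [|m [ST F]] //.
  by rewrite exec_nseq; apply: growP.
have Tnu := fractional_total Fg (_ : T < 2 ^ l.+1); rewrite ltn_exp2l // in Tnu.
have {}Tnu := Tnu (ltnSn l).
set f := rounding K.
have loop m : m <= K -> let S := exec port b (flatten [seq f i | i <- iota 0 m]) Sg in
  [/\ settled l S0 S, powers_between m K (arcs S)
    & (pot L K 0 (arcs Sg) <= (L ^ m)%N%:Z * pot L K m (arcs S))%R].
  elim: m => [|m IH] mK; last first.
    have [ST P G] := IH (ltnW mK); rewrite exec_iota.
    have [ST' P' G'] := roundingP I0 ST mK bK P; split=> //.
    apply: Order.POrderTheory.le_trans G _; rewrite expnSr PoszM -GRing.mulrA.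
    by apply: Num.Theory.ler_wpM2l.
  split=> // [u v|]; last by rewrite expn0 GRing.mul1r.
  have [oT _ Xp Xz _] := Fg; case auv: (active l S0 u v); last by left; rewrite Xz ?auv.
  right; have [j Xj] := Xp u v auv; exists j => //=.
  have := leq_trans (outs_ge (arcs Sg) u v) (oT u); rewrite Xj leq_exp2l // => /leq_trans; apply.
  exact: leq_addr.
have [ST P G] := loop K (leqnn K); rewrite -/L -/K; move: ST P G; set Sr := exec _ _ _ Sg.
move=> ST P G.
have [KI AI] := isolateP (leq_ltn_trans (leq0n l) lb) I0 ST.
have X2 u v : arcs Sr u v = 0 \/ arcs Sr u v = 2 ^ K.
  case: (P u v) => [|[j]]; first by left.
  by rewrite -eqn_leq => /eqP <-; right.
have uP u v : arcs (exec port b [:: isolate] Sr) u v != 0 = unique_arc (arcs Sr) u v.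
  by rewrite /= AI; case: (unique_arc _ _ _).
have outE u : outdeg (arcs (exec port b [:: isolate] Sr)) u <= 1.
  rewrite leqNgt; apply/negP => /card_gt1P[v [w [vi wi vw]]].
  move: vi wi; rewrite !inE !uP => /and3P[vz /eqP o1 _] /and3P[wz _ _].
  have : 1 < outdeg (arcs Sr) u by apply/card_gt1P; exists v, w; rewrite !inE.
  by rewrite o1.
have inE' u : indeg (arcs (exec port b [:: isolate] Sr)) u <= 1.
  rewrite leqNgt; apply/negP => /card_gt1P[v [w [vi wi vw]]].
  move: vi wi; rewrite !inE !uP => /and3P[vz _ /eqP o1] /and3P[wz _ _].
  have : 1 < indeg (arcs Sr) u by apply/card_gt1P; exists v, w; rewrite !inE.
  by rewrite o1.
split=> // [u v|].
  rewrite uP => /and3P[az _ _]; have [_ _ Z] := ST.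
  by apply: contraNT az => /Z ->.
have -> : #|[set x : V * V | arcs (exec port b [:: isolate] Sr) x.1 x.2 != 0]| =
    #|[set x : V * V | unique_arc (arcs Sr) x.1 x.2]|.
  by apply: eq_card => x; rewrite !inE uP.
have := potential_extract X2; set U := #|_|.
have := pot_start Fg KT (inverse_bernoulli K); rewrite -/L.
rewrite /pot subnn !expn0 mul1n in G *.
move=> H1 H2; have {}H1 := Order.POrderTheory.le_trans H1 G.
have H3 := Num.Theory.ler_wpM2l (isT : (0 <= (L ^ K)%N%:Z)%R) H2.
have {H1 H2 H3} := Order.POrderTheory.le_trans H1 H3.
rewrite -PoszM lez_nat leq_pmul2l ?expn_gt0 ?L0 // KT => H.
have T0 : 0 < T by rewrite expn_gt0.
move: H; rewrite expnMn -[T ^ 2]mulnn -[8 ^ 2]/64 => H.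
rewrite -(leq_pmul2l (_ : 0 < T * T)) ?muln_gt0 ?T0 //.
by move: H (leq_mul (leqnn T) Tnu); move: (nu _) (volume _) => x y; lia.
Qed.

Lemma exec_foreach (T : eqType) (f : T -> seq step) (s : seq T)
    (P : (V -> local_state) -> Prop) (Q : T -> (V -> local_state) -> Prop) S :
  P S ->
  (forall x S', x \in s -> P S' -> P (exec port b (f x) S') /\ Q x (exec port b (f x) S')) ->
  (forall x y S', y \in s -> P S' -> Q x S' -> Q x (exec port b (f y) S')) ->
  let S' := exec port b (flatten [seq f x | x <- s]) S in
  P S' /\ forall x, x \in s -> Q x S'.
Proof.
move=> PS; elim/last_ind: s => [|s x IH] PQ QQ //.
rewrite map_rcons flatten_rcons exec_cat.
have sub y : y \in s -> y \in rcons s x by rewrite mem_rcons inE => ->; rewrite orbT.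
have [P1 Q1] := IH (fun y S' ys => PQ y S' (sub y ys)) (fun y z S' zs => QQ y z S' (sub z zs)).
have xs : x \in rcons s x by rewrite mem_rcons mem_head.
have [P2 Q2] := PQ x _ xs P1; split=> // y.
by rewrite mem_rcons inE => /orP[/eqP -> //|/Q1 Qy]; exact: QQ.
Qed.

(** * Maximal matchings of directed paths *)

Definition extends S S' :=
  (forall v, halt S' v = halt S v) /\
  (forall v, ~~ unmatched (S v) -> mate (base (S' v)) = mate (base (S v))).

Lemma extends_unmatched S S' v : extends S S' -> unmatched (S' v) -> unmatched (S v).
Proof. by case=> _ E; apply: contraLR => h; rewrite /unmatched E. Qed.

Lemma extends_trans S1 S2 S3 : extends S1 S2 -> extends S2 S3 -> extends S1 S3.
Proof.
case=> h1 E1 [h2 E2]; split=> v; first by rewrite h2.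
by move=> m; rewrite E2 ?E1 // /unmatched E1.
Qed.

Section MatchPaths.
Variables (l w cb : nat) (S0 : V -> local_state).
Hypotheses (I0 : consistent S0) (id_small : forall v, id v < 2 ^ w).
Hypotheses (b_gt0 : 0 < b) (wb : 2 * w + 2 <= 2 ^ b) (wcb : 2 * w + 2 <= 2 ^ cb).
Let X := arcs S0.
Hypotheses (X_active : forall u v, X u v != 0 -> active l S0 u v).
Hypotheses (X_out : forall u, outdeg X u <= 1) (X_in : forall v, indeg X v <= 1).

Lemma out_uniq u v v' : X u v != 0 -> X u v' != 0 -> v = v'.
Proof.
move=> h h'; apply/eqP; apply: contraTT (X_out u) => nv; rewrite -ltnNge.
by apply/card_gt1P; exists v, v'; rewrite !inE.
Qed.

Lemma in_uniq u u' v : X u v != 0 -> X u' v != 0 -> u = u'.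
Proof.
move=> h h'; apply/eqP; apply: contraTT (X_in v) => nv; rewrite -ltnNge.
by apply/card_gt1P; exists u, u'; rewrite !inE.
Qed.

Lemma arc_edge u v : X u v != 0 -> e u v.
Proof. by case/X_active/and4P. Qed.

Lemma arc_xout u v : e u v -> xout (S0 u) (pt u v) = X u v.
Proof. by rewrite /X /arcs => ->. Qed.

Lemma out_portE u v : X u v != 0 -> out_port (S0 u) = pt u v.
Proof.
move=> Xuv; rewrite /out_port (inv_deg I0); have uv := arc_edge Xuv.
apply: find_port; rewrite ?arc_xout // => v' uv'; rewrite arc_xout // => Xuv'.
exact: out_uniq Xuv' Xuv.
Qed.

Lemma color_lt v : color w (S0 v) < 2 * w + 2.
Proof.
have bitle j i : bit j i <= 1 by exact: leq_b1.
rewrite /color; case: ifP => _; last by have := bitle 0 (ident (base (S0 v))); lia.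
set j := first_diff _ _ _; have := bitle j (ident (base (S0 v))).
have : j <= w by rewrite -[X in _ <= X](size_iota 0 w); exact: find_size.
lia.
Qed.

Lemma color_arc u v : X u v != 0 ->
  color w (S0 u) = 2 * first_diff w (id u) (id v) + bit (first_diff w (id u) (id v)) (id u).
Proof.
move=> Xuv; rewrite /color (out_portE Xuv) (inv_deg I0) pt_lt (arc_edge Xuv).
by rewrite (inv_nbr I0 (arc_edge Xuv)) (inv_id I0).
Qed.

Lemma first_diffP u v : id u < id v ->
  bit (first_diff w (id u) (id v)) (id u) != bit (first_diff w (id u) (id v)) (id v).
Proof.
move=> uv; have hasP : has (fun j => bit j (id u) != bit j (id v)) (iota 0 w).
  apply/negPn/negP => /hasPn H; suff E : id u = id v by move: uv; rewrite E ltnn.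
  apply: (@bits_inj w) => // k kw; apply/eqP/negPn; apply: H; by rewrite mem_iota.
have := nth_find 0 hasP; rewrite has_find size_iota in hasP.
by rewrite nth_iota // add0n.
Qed.

(** Equal colours would name the same bit position and the same bit there, but [id u] and [id v]
    differ at the position named by [u]. A vertex without an outgoing arc is coloured as if its
    position were 0. *)
Lemma color_neq u v : X u v != 0 -> color w (S0 u) != color w (S0 v).
Proof.
move=> Xuv; have [_ _ _ iuv] := and4P (X_active Xuv).
have dj := first_diffP iuv; rewrite (color_arc Xuv).
move: (first_diff _ _ _) dj => j dj.
case: (pickP (fun v' => X v v' != 0)) => [v' Xvv'|no].
  rewrite (color_arc Xvv'); move: (first_diff _ _ _) => j'.
  apply: contraNneq dj => E.
  have jj : j = j' by move: E; do 2 case: (bit _ _) => /=; lia.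
  by move: E; rewrite -jj; do 2 case: (bit _ _) => /=; lia.
have -> : color w (S0 v) = bit 0 (id v).
  rewrite /color (inv_id I0) /out_port (inv_deg I0) find_no_port ?ltnn // => v' vv'.
  by rewrite arc_xout // no.
apply: contraNneq dj; case: j => [|j]; last by do 2 case: (bit _ _) => /=; lia.
by rewrite muln0 add0n; do 2 case: (bit _ _).
Qed.

(** Outgoing arcs and colours stay those of [S0], so the classes of arcs are fixed beforehand;
    [par_new] confines new pairs to the arcs of [X]. *)
Record partial S : Prop := Partial {
  par_xout : forall v, xout (S v) = xout (S0 v);
  par_core : forall v, let z := base (S v) in let z0 := base (S0 v) in
    (deg z, ident z, nbr_id z, stopped z) = (deg z0, ident z0, nbr_id z0, stopped z0);
  par_halt : forall v, halt S0 v -> xin (S v) = xin (S0 v);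
  par_col : forall u v, X u v != 0 -> nbr_col (base (S u)) (pt u v) = color w (S0 v);
  par_mate : forall u p, mate (base (S u)) = Some p -> p < size (port u);
  par_sym : forall u v, mates S u v -> mates S v u;
  par_ext : forall v, ~~ unmatched (S0 v) -> mate (base (S v)) = mate (base (S0 v));
  par_new : forall u v, mates S u v -> unmatched (S0 u) -> X u v != 0 \/ X v u != 0 }.

Lemma partial_halt S v : partial S -> halt S v = halt S0 v.
Proof. by move=> /par_core /(_ v) []; rewrite /halt. Qed.

Lemma partial_extends S : partial S -> extends S0 S.
Proof. by move=> P; split=> [v|v]; [exact: partial_halt | exact: par_ext]. Qed.

Lemma partial_deg S v : partial S -> dg (S v) = size (port v).
Proof. by move=> /par_core /(_ v) [+ _ _ _]; rewrite -(inv_deg I0). Qed.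

Lemma partial_out_port S v : partial S -> out_port (S v) = out_port (S0 v).
Proof. by move=> P; rewrite /out_port (par_xout P) (partial_deg _ P) (inv_deg I0). Qed.

Lemma partial_color S v : partial S -> color w (S v) = color w (S0 v).
Proof.
move=> P; rewrite /color (partial_out_port v P) (partial_deg _ P) (inv_deg I0).
by case: (par_core P v) => _ -> -> _.
Qed.

Lemma partial_consistent S : partial S -> consistent S.
Proof.
move=> P; have E := partial_extends P.
split=> [v|v|u v uv|u p|u v|v|v p].
- exact: partial_deg.
- by case: (par_core P v) => _ -> _ _; rewrite (inv_id I0).
- by case: (par_core P u) => _ _ -> _; rewrite (inv_nbr I0).
- exact: par_mate P u p.
- exact: par_sym P u v.
- rewrite (partial_halt v P) => /(inv_halt I0)[h|h]; [left|right=> u vu].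
    by apply: contra h; exact: extends_unmatched.
  by apply: contra (h u vu); exact: extends_unmatched.
- rewrite (partial_halt v P) => hv; rewrite (par_xout P) (par_halt P hv).
  exact: inv_zero I0 v p hv.
Qed.

Lemma exchange_colorsP : partial (S0 |> exchange_colors w).
Proof.
set S := S0 |> _.
have [B H] : keeps S0 S by apply: keeps_step.
have m := keeps_mate (conj B H).
split=> [v|v|v hv|u v Xuv|u p|u v|v _|u v].
- by case hv: (halt S0 v); [rewrite H | rewrite /S step_on ?hv].
- by move=> z z0; case: (B v) => -> -> -> _ ->.
- by rewrite H.
- have [hu hv] := active_on I0 (X_active Xuv).
  rewrite /S step_on //= receivedE ?(arc_edge Xuv) ?(negbTE hv) //.
  exact: leq_trans (color_lt v) wb.
- by rewrite m; exact: inv_mate.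
- by rewrite /mates !m; exact: inv_sym I0 u v.
- exact: m.
- by rewrite /mates m => /andP[uv /eqP mu]; rewrite /unmatched mu.
Qed.

Section OneClass.
Variables (j : nat) (beta : bool) (S : V -> local_state).
Hypothesis P : partial S.
Let S1 := S |> choose_mate w j beta.
Let S2 := S1 |> accept_mate.

Definition fires u v := [&& X u v != 0, unmatched (S u), unmatched (S v),
  bit j (color w (S0 u)) == beta & bit j (color w (S0 v)) == ~~ beta].

Lemma arc_on u v : X u v != 0 -> ~~ halt S u /\ ~~ halt S v.
Proof. by rewrite !(partial_halt _ P) => /X_active /(active_on I0). Qed.

Lemma choose_received u v : e u v ->
  received (choose_mate w j beta) S u (pt u v) = ~~ halt S v && unmatched (S v).
Proof.
move=> uv; rewrite receivedE //=; first by case: (halt S v).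
by apply: leq_ltn_trans (leq_b1 _) _; rewrite -{1}(expn0 2) ltn_exp2l.
Qed.

Lemma choose_fires u v : fires u v -> S1 u = set_base (set_mate (Some (pt u v))) (S u).
Proof.
case/and5P=> Xuv fu fv bu bv; have [hu hv] := arc_on Xuv; have uv := arc_edge Xuv.
rewrite /S1 step_on //= (partial_out_port u P) (out_portE Xuv) (partial_deg u P) pt_lt uv fu.
by rewrite choose_received // hv fv (partial_color u P) bu (par_col P Xuv) bv.
Qed.

Lemma choose_idle u : (forall v, ~~ fires u v) -> S1 u = S u.
Proof.
move=> nf; case hu: (halt S u); first by rewrite /S1 step_off.
rewrite /S1 step_on ?hu //=; case: ifP => // /and5P[fu pd r1 bu bv].
rewrite (partial_deg u P) in pd; case: (portP pd) => v uv pE.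
have Xuv : X u v != 0.
  rewrite -arc_xout // pE -(par_xout P) /out_port.
  set l0 := iota _ _; have hP : has (fun p => xout (S u) p != 0) l0.
    by rewrite has_find size_iota (partial_deg u P); exact: pd.
  have := nth_find 0 hP; rewrite nth_iota //.
  by rewrite (partial_deg u P); exact: pd.
rewrite -pE choose_received // eqb1 in r1; case/andP: r1 => _ fv.
have := nf v; rewrite /fires Xuv fu fv -(partial_color u P) bu.
by rewrite -pE (par_col P Xuv) in bv; rewrite bv.
Qed.

Lemma choose_other u : [/\ xout (S1 u) = xout (S u), xin (S1 u) = xin (S u) &
  let z := base (S1 u) in let z0 := base (S u) in
  (deg z, ident z, nbr_id z, nbr_col z, stopped z) =
  (deg z0, ident z0, nbr_id z0, nbr_col z0, stopped z0)].
Proof.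
by case: (pickP (fires u)) => [v /choose_fires ->|nf] //; rewrite choose_idle // => v; rewrite nf.
Qed.

Lemma choose_halt u : halt S1 u = halt S u.
Proof. by have [_ _ []] := choose_other u; rewrite /halt. Qed.

Lemma choose_deg u : dg (S1 u) = size (port u).
Proof. by have [_ _ []] := choose_other u; rewrite /dg => -> *; exact: partial_deg P. Qed.

Lemma accept_received u v : e u v ->
  received accept_mate S1 u (pt u v) =
  (~~ halt S v && (mate (base (S1 v)) == Some (pt v u)) : nat).
Proof.
move=> uv; rewrite receivedE //= ?choose_halt; first by case: (halt S v).
by apply: leq_ltn_trans (leq_b1 _) _; rewrite -{1}(expn0 2) ltn_exp2l.
Qed.

(** A pair older than this class would be symmetric, so a pointer to an unmatched neighbour must be
    a fresh proposal. *)
Lemma chosen_by u v : e u v -> unmatched (S1 v) ->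
  mate (base (S1 u)) = Some (pt u v) -> fires u v.
Proof.
move=> uv fv mu; case: (pickP (fires u)) => [v' fuv'|nf].
  by move: mu; rewrite (choose_fires fuv') /= => -[] /esym/(pt_inj uv) ->.
have muv : mates S u v by rewrite /mates uv -mu choose_idle ?eqxx // => v'; rewrite nf.
have /andP[_ /eqP mv] := par_sym P muv.
move: fv; rewrite /unmatched choose_idle ?mv // => v'; apply/negP => /and5P[_].
by rewrite /unmatched mv.
Qed.

(** The head has the opposite bit and so proposes nothing itself, and it receives a single proposal
    because only one arc enters it. *)
Lemma accept_fires u v : fires u v ->
  S2 v = set_base (set_mate (Some (pt v u))) (S v) /\ S2 u = S1 u.
Proof.
move=> fuv; have /and5P[Xuv fu fv bu bv] := fuv.
have [hu hv] := arc_on Xuv; have uv := arc_edge Xuv; split; last first.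
  by rewrite /S2 step_on ?choose_halt //= (choose_fires fuv) /unmatched.
have S1v : S1 v = S v.
  apply: choose_idle => v'; apply/negP => /and5P[_ _ _ bv' _].
  by move: bv; rewrite (eqP bv'); case: (beta).
rewrite /S2 step_on ?choose_halt //= choose_deg.
rewrite (@find_port v u (fun p => received accept_mate S1 v p == 1)).
- by rewrite S1v fv pt_lt e_sym uv.
- by rewrite e_sym.
- by rewrite accept_received 1?e_sym // hu (choose_fires fuv) /= eqxx.
- move=> u' vu'; rewrite accept_received // eqb1 => /andP[_ /eqP mu'].
  have /and5P[Xu' _ _ _ _] : fires u' v by apply: chosen_by; rewrite 1?e_sym ?S1v.
  exact: in_uniq Xu' Xuv.
Qed.

Lemma accept_idle v : (forall u, ~~ fires u v) -> S2 v = S1 v.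
Proof.
move=> nf; case hv: (halt S v); first by rewrite /S2 step_off ?choose_halt.
rewrite /S2 step_on ?choose_halt ?hv //= choose_deg; case: ifP => // /andP[fv].
rewrite find_no_port ?ltnn // => u vu; rewrite accept_received // eqb1.
apply/negP => /andP[_ /eqP mu].
by have := nf u; rewrite (chosen_by _ fv mu) // e_sym.
Qed.

Lemma class_idle u : (forall v, ~~ fires u v) -> (forall v, ~~ fires v u) -> S2 u = S u.
Proof. by move=> h1 h2; rewrite accept_idle ?choose_idle. Qed.

Lemma class_mate u v : fires u v ->
  mate (base (S2 u)) = Some (pt u v) /\ mate (base (S2 v)) = Some (pt v u).
Proof. by move=> f; have [-> ->] := accept_fires f; rewrite (choose_fires f). Qed.

Lemma class_other u : [/\ xout (S2 u) = xout (S u), xin (S2 u) = xin (S u) &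
  let z := base (S2 u) in let z0 := base (S u) in
  (deg z, ident z, nbr_id z, nbr_col z, stopped z) =
  (deg z0, ident z0, nbr_id z0, nbr_col z0, stopped z0)].
Proof.
case: (pickP (fires^~ u)) => [v /accept_fires [-> _] //|nf].
by rewrite accept_idle; [exact: choose_other | move=> v; rewrite nf].
Qed.

Lemma class_cases u : [\/ exists v, fires u v, exists v, fires v u | S2 u = S u].
Proof.
case: (pickP (fires u)) => [v f|nf]; first by constructor 1; exists v.
case: (pickP (fires^~ u)) => [v f|nf']; first by constructor 2; exists v.
by constructor 3; apply: class_idle => v; rewrite ?nf ?nf'.
Qed.

Lemma class_extends : extends S S2.
Proof.
split=> u; first by have [_ _ []] := class_other u; rewrite /halt.
move=> mu; case: (class_cases u) => [[v]|[v]|-> //] /and5P[_ fu fv _ _].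
  by rewrite fu in mu.
by rewrite fv in mu.
Qed.

Lemma class_partial : partial S2.
Proof.
have edge u v : fires u v -> e u v by case/and5P=> /arc_edge.
have step u v : mates S2 u v -> [\/ fires u v, fires v u | S2 u = S u /\ mates S u v].
  case/andP=> uv /eqP mu; case: (class_cases u) => [[v' f]|[v' f]|E].
  - constructor 1; move: mu; rewrite (class_mate f).1 => -[] /esym/(pt_inj uv) vE.
    by rewrite vE.
  - constructor 2; move: mu; rewrite (class_mate f).2 => -[] /esym/(pt_inj uv) vE.
    by rewrite vE.
  - by constructor 3; split=> //; rewrite /mates uv -E mu eqxx.
split=> [v|v|v hv|u v Xuv|u p|u v|v mv|u v].
- by have [-> _ _] := class_other v; rewrite (par_xout P).
- by move=> z z0; rewrite /z /z0; have [_ _ [-> -> -> _ ->]] := class_other v; exact: par_core P v.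
- by have [_ -> _] := class_other v; rewrite (par_halt P hv).
- by have [_ _ [_ _ _ -> _]] := class_other u; rewrite (par_col P).
- case: (class_cases u) => [[v f]|[v f]|->]; last exact: par_mate P u p.
    by rewrite (class_mate f).1 => -[<-]; rewrite pt_lt edge.
  by rewrite (class_mate f).2 => -[<-]; rewrite pt_lt e_sym edge.
- move/[dup] => /step[f|f|[E /(par_sym P) m]] /andP[uv mu].
  + by rewrite /mates e_sym uv (class_mate f).2 eqxx.
  + by rewrite /mates e_sym uv (class_mate f).1 eqxx.
  + have /andP[vu mv] := m; rewrite /mates vu class_extends.2 //.
    by rewrite /unmatched (eqP mv).
- rewrite class_extends.2 ?(par_ext P) // /unmatched (par_ext P) //.
- case/step=> [/and5P[-> _ _ _ _]|/and5P[-> _ _ _ _]|[_ m]]; [by left | by right |].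
  exact: par_new P u v m.
Qed.

Lemma class_covers u v : X u v != 0 -> bit j (color w (S0 u)) = beta ->
  bit j (color w (S0 v)) = ~~ beta -> ~~ unmatched (S2 u) || ~~ unmatched (S2 v).
Proof.
move=> Xuv bu bv; case f: (fires u v).
  by rewrite /unmatched (class_mate f).1.
have {f} : ~~ unmatched (S u) || ~~ unmatched (S v).
  by move: f; rewrite /fires Xuv bu bv !eqxx !andbT /= => /negbT; rewrite negb_and.
by case/orP=> h; apply/orP; [left|right]; apply: contra h; apply: extends_unmatched class_extends.
Qed.

End OneClass.

(** The colours at the ends of an arc differ in some bit below [cb]; the class of this bit and of
    the tail's value there covers the arc. *)
Lemma match_pathsP : let S := exec port b (match_paths w cb) S0 in
  [/\ consistent S, extends S0 S,
      forall u v, mates S u v -> unmatched (S0 u) -> X u v != 0 \/ X v u != 0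
    & forall u v, X u v != 0 -> ~~ unmatched (S u) || ~~ unmatched (S v)].
Proof.
pose Q (x : nat * bool) S := forall u v, X u v != 0 -> bit x.1 (color w (S0 u)) = x.2 ->
  bit x.1 (color w (S0 v)) = ~~ x.2 -> ~~ unmatched (S u) || ~~ unmatched (S v).
rewrite /match_paths -cat1s exec_cat.
have [||P' Q'] := @exec_foreach _ (fun x : nat * bool => [:: choose_mate w x.1 x.2; accept_mate])
  [seq (j, beta) | j <- iota 0 cb, beta <- [:: false; true]] partial Q _ exchange_colorsP.
- move=> x S _ P; split; first exact: class_partial.
  by move=> u v Xuv; exact: class_covers.
- move=> x y S _ P QS u v Xuv b1 b2.
  case/orP: (QS u v Xuv b1 b2) => h; apply/orP; [left|right]; apply: contra h;
    exact: extends_unmatched (class_extends _ _ P).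
split; [exact: partial_consistent | exact: partial_extends | exact: par_new P' |].
move=> u v Xuv.
have /hasP[j jcb bj] : has (fun j => bit j (color w (S0 u)) != bit j (color w (S0 v))) (iota 0 cb).
  apply/negPn/negP => /hasPn same; have /eqP[] := color_neq Xuv.
  apply: (@bits_inj cb); [exact: leq_trans (color_lt u) wcb|exact: leq_trans (color_lt v) wcb|].
  by move=> j jcb; apply/eqP/negPn; apply: same; rewrite mem_iota.
apply: (Q' (j, bit j (color w (S0 u)))) => //.
  by apply: allpairs_f => //; case: (bit _ _).
by move: bj => /=; do 2 case: (bit _ _).
Qed.

End MatchPaths.

(** * Iterations, phases and the schedule *)

Lemma mates_uniq S u v v' : mates S u v -> mates S u v' -> v = v'.
Proof. by case/andP=> uv /eqP m /andP[_]; rewrite m => /eqP[]; exact: pt_inj. Qed.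

Lemma matched_mates S u : consistent S -> ~~ unmatched (S u) -> exists v, mates S u v.
Proof.
move=> I; rewrite /unmatched; case mu: (mate _) => [p|] // _.
have [v uv pE] := portP (inv_mate I mu).
by exists v; rewrite /mates uv mu pE eqxx.
Qed.

Lemma mates_matched S u v : mates S u v -> ~~ unmatched (S u).
Proof. by case/andP=> _ /eqP mu; rewrite /unmatched mu. Qed.

Lemma active_extends l S S' u v : consistent S -> consistent S' -> extends S S' ->
  active l S' u v -> active l S u v.
Proof.
move=> I I' E /and4P[uv /andP[fu du] /andP[fv dv] iuv]; rewrite /active uv iuv /light.
rewrite !(extends_unmatched E) //; move: du dv.
by rewrite !(inv_deg I) !(inv_deg I') => -> ->.
Qed.

(** The old [nu] is at most 64 times the number of arcs, hence at most 256 times the number of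
    matched arcs, and [nu] drops by at least that number. *)
Lemma thinningP (w cb l : nat) S0 : consistent S0 -> (forall v, id v < 2 ^ w) ->
  2 * w + 2 <= 2 ^ b -> 2 * w + 2 <= 2 ^ cb -> #|V|.+1 * 2 ^ (l + 3) < 2 ^ b ->
  let S := exec port b (thinning w cb l) S0 in
  [/\ consistent S, extends S0 S & 256 * nu (active l S) <= 255 * nu (active l S0)].
Proof.
move=> I0 idw wb wcb bK; rewrite /thinning exec_cat.
have [K1 A1 O1 N1 C1] := thin_stepsP I0 bK; set S1 := exec _ _ _ S0 in K1 A1 O1 N1 C1 *.
have I1 := inv_keeps K1 I0.
have b0 : 0 < b.
  by rewrite lt0n; apply: contraTneq wb => ->; rewrite -ltnNge expn0; lia.
have A1' u v : arcs S1 u v != 0 -> active l S1 u v by rewrite (active_keeps _ _ _ K1); exact: A1.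
have [I2 E2 new2 cov2] := match_pathsP I1 idw b0 wb wcb A1' O1 N1.
set S2 := exec _ _ _ S1 in I2 E2 new2 cov2 *.
have E1 : extends S0 S1 by split=> v; [exact: keeps_halt | rewrite (keeps_mate K1)].
split=> //; first exact: extends_trans E1 E2.
have nuE : nu (active l S0) = nu (active l S1).
  rewrite /nu; apply: eq_bigl => N; apply: eq_forallb => x.
  by rewrite (active_keeps _ _ _ K1).
pose M := [set x : V * V | (arcs S1 x.1 x.2 != 0) && mates S2 x.1 x.2].
(* The order of the identifiers fixes the orientation, so an arc of [M] is determined by either
   endpoint. *)
have MP x z : x \in M -> touch z x -> exists2 z', mates S2 z z' &
    if id z < id z' then x = (z, z') else x = (z', z).
  case: x => a c; rewrite inE /= => /andP[/A1'/and4P[_ _ _ iac] mac] /orP[]/eqP /= ->.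
    by exists c => //; rewrite iac.
  by exists a; [exact: inv_sym I2 _ _ mac | rewrite ltnNge ltnW].
have Mm : arc_matching (active l S1) M.
  apply/arc_matchingP; split=> [[a c]|x y z xM yM]; first by rewrite inE => /andP[/A1'].
  case/(MP _ _ xM) => z' mz xE /(MP _ _ yM) [z'' mz' yE].
  have zE := mates_uniq mz mz'; move: xE yE; rewrite -zE.
  by case: ifP => _ -> ->.
have card_arcs : #|[set x : V * V | arcs S1 x.1 x.2 != 0]| <= 4 * #|M|.
  apply: arc_card_le => // u v Xuv.
  suff H z z' : unmatched (S1 z) -> mates S2 z z' -> exists2 x, x \in M & touch z x.
    have /and4P[_ /andP[fu _] /andP[fv _] _] := A1' u v Xuv.
    case/orP: (cov2 u v Xuv) => /(matched_mates I2)[z m].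
      by have [x xM t] := H u z fu m; exists x; rewrite // t.
    by have [x xM t] := H v z fv m; exists x; rewrite // t orbT.
  move=> fz m; case: (new2 z z' m fz) => h.
    by exists (z, z'); [rewrite inE h m | rewrite /touch eqxx].
  by exists (z', z); [rewrite inE h (inv_sym I2 m) | rewrite /touch eqxx orbT].
have nM : nu (active l S2) + #|M| <= nu (active l S1).
  apply: (nu_removed Mm) => [u v|u v z x]; first exact: active_extends.
  move=> /and4P[_ /andP[fu _] /andP[fv _] _] xM tz; apply/negP => /(MP _ _ xM)[z' m _].
  by have := mates_matched m; case/orP: tz => /eqP /= ->; rewrite ?fu ?fv.
by move: C1 nM; rewrite nuE; move: (nu _) (nu _) card_arcs; lia.
Qed.

Definition saturated l S := forall u v, ~~ active l S u v.

(** Each block of 256 iterations at least halves [nu], which is below [2 ^ (lg n).+1] at the start;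
    after [(lg n).+1] blocks it is below 1. *)
Lemma thinning_iterP (w cb l : nat) S0 : consistent S0 -> (forall v, id v < 2 ^ w) ->
  2 * w + 2 <= 2 ^ b -> 2 * w + 2 <= 2 ^ cb -> #|V|.+1 * 2 ^ (l + 3) < 2 ^ b ->
  let S := exec port b (flatten (nseq (256 * (lg #|V|).+1) (thinning w cb l))) S0 in
  [/\ consistent S, extends S0 S & saturated l S].
Proof.
move=> I0 idw wb wcb bK.
have H m : let S := exec port b (flatten (nseq m (thinning w cb l))) S0 in
    [/\ consistent S, extends S0 S & 256 ^ m * nu (active l S) <= 255 ^ m * nu (active l S0)].
  elim: m => [|m [I E D]]; first by [].
  rewrite exec_nseq; set S := exec _ _ _ S0 in I E D *.
  have [I' E' D'] := thinningP I idw wb wcb bK; split=> //; first exact: extends_trans E E'.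
  rewrite !expnSr -!mulnA; apply: leq_trans (leq_mul (leqnn (256 ^ m)) D') _.
  by rewrite mulnCA [X in _ <= X]mulnCA leq_mul2l D orbT.
have [I E D] := H (256 * (lg #|V|).+1); split=> //; apply: nu_eq0; apply/eqP.
have nV : nu (active l S0) < 2 ^ (lg #|V|).+1.
  apply: leq_ltn_trans (nu_le _) _; apply: (@leq_ltn_trans (2 ^ lg #|V|)).
    by apply: leq_trans (up_logP _ _) => //; exact: leq_maxr.
  by rewrite ltn_exp2l.
move: D nV; move: (nu _) (nu _) => y x; move: (lg #|V|).+1 => k.
have := double_expn 255; rewrite -[255.+1]/256.
have : 0 < 255 ^ 256 by rewrite expn_gt0.
rewrite !expnM; move: (255 ^ 256) (256 ^ 256) => p r p0 pr D yk.
have D2 : 2 ^ k * (p ^ k) <= r ^ k by rewrite -expnMn; case: (k) => [|k'] //; rewrite leq_exp2r.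
have pk : 0 < p ^ k by rewrite expn_gt0 p0.
move: D D2 pk yk; move: (p ^ k) (r ^ k) (2 ^ k) => P R Q D D2 pk yk.
rewrite -leqn0 leqNgt; apply/negP => x0.
have : P * y < P * Q by rewrite ltn_pmul2l.
have : R <= R * x by rewrite leq_pmulr.
lia.
Qed.

(** The two port numbers of an arc determine it from either end, so each pair of ports yields
    directed paths. Light vertices have only ports below [2 ^ l], so every active arc gets its
    turn. *)
Lemma port_by_portP (w cb l : nat) S0 : consistent S0 -> (forall v, id v < 2 ^ w) ->
  0 < b -> 2 * w + 2 <= 2 ^ b -> 2 * w + 2 <= 2 ^ cb ->
  let S := exec port b (port_by_port w cb l) S0 in
  [/\ consistent S, extends S0 S & saturated l S].
Proof.
move=> I0 idw b0 wb wcb.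
pose P S := consistent S /\ extends S0 S.
pose Q (x : nat * nat) S := P S /\
  forall u v, e u v -> pt u v = x.1 -> pt v u = x.2 -> ~~ active l S u v.
have step x S : P S ->
    let S' := exec port b (activate l (pred1 x.1) (pred1 x.2) :: match_paths w cb) S in
    [/\ P S', Q x S' & extends S S'].
  move=> [I E]; rewrite -cat1s exec_cat.
  have [K1 A1] := activateP l (pred1 x.1) (pred1 x.2) b0 I.
  set S1 := exec _ _ [:: _] S; rewrite -/S1 in K1 A1.
  have I1 := inv_keeps K1 I.
  have E1 : extends S S1 by split=> v; [exact: keeps_halt | rewrite (keeps_mate K1)].
  have arcP u v : arcs S1 u v != 0 -> [/\ active l S1 u v, pt u v = x.1 & pt v u = x.2].
    rewrite A1 eqb0 negbK (active_keeps _ _ _ K1) => /and3P[a p q].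
    by split=> //; apply/eqP.
  have o1 u : outdeg (arcs S1) u <= 1.
    rewrite leqNgt; apply/negP => /card_gt1P[v [v' [/arcP[a p _] /arcP[_ p' _] /eqP[]]]].
    by apply: (@pt_inj u); rewrite ?p ?p' //; case/and4P: a.
  have n1 u : indeg (arcs S1) u <= 1.
    rewrite leqNgt; apply/negP => /card_gt1P[v [v' [/arcP[a _ p] /arcP[_ _ p'] /eqP[]]]].
    by apply: (@pt_inj u); rewrite ?p ?p' // e_sym; case/and4P: a.
  have [I2 E2 _ cov] := match_pathsP I1 idw b0 wb wcb (fun u v h => let: And3 a _ _ := arcP u v h in a) o1 n1.
  have PS2 : P (exec port b (match_paths w cb) S1).
    by split=> //; apply: extends_trans E _; apply: extends_trans E1 E2.
  split=> //; last exact: extends_trans E1 E2.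
  split=> // u v uv p q; apply/negP => a2.
  have a1 := active_extends I1 I2 E2 a2.
  have Xuv : arcs S1 u v != 0 by rewrite A1 -(active_keeps _ _ _ K1) a1 /= p q !eqxx.
  case/and4P: a2 => _ /andP[fu _] /andP[fv _] _.
  by have := cov u v Xuv; rewrite fu fv.
have [|||[I E] Q'] := @exec_foreach _ (fun x : nat * nat =>
    activate l (pred1 x.1) (pred1 x.2) :: match_paths w cb)
  [seq (i, j) | i <- iota 0 (2 ^ l), j <- iota 0 (2 ^ l)] P Q S0.
- by [].
- by move=> x S _ /(step x)[].
- move=> x y S _ PS [_ QS]; have [[I' E'] _ E] := step y S PS; split=> // u v uv p q.
  by apply: contra (QS u v uv p q); exact: active_extends (proj1 PS) I' E.
split=> // u v; apply/negP => a; have /and4P[uv /andP[_ du] /andP[_ dv] _] := a.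
have [|_ H] := Q' (pt u v, pt v u).
  apply: allpairs_f; rewrite mem_iota /= add0n.
    by apply: leq_trans du; rewrite (inv_deg I) pt_lt.
  by apply: leq_trans dv; rewrite (inv_deg I) pt_lt e_sym.
by have := H u v uv erefl erefl; rewrite a.
Qed.

Lemma finishP S : 0 < b -> consistent S ->
  let S' := S |> finish in
  [/\ consistent S', forall v, mate (base (S' v)) = mate (base (S v)) &
      forall v, ~~ unmatched (S v) \/ (forall u, e v u -> ~~ unmatched (S u)) -> halt S' v].
Proof.
move=> b0 I S'.
have rcv v u : e v u -> received finish S v (pt v u) = ~~ halt S u && unmatched (S u).
  move=> vu; rewrite receivedE //=; first by case: (halt S u).
  by apply: leq_ltn_trans (leq_b1 _) _; rewrite -{1}(expn0 2) ltn_exp2l.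
have SE v : halt S v = false -> S' v =
    if ~~ unmatched (S v) || [forall u, e v u ==> (halt S u || ~~ unmatched (S u))]
    then LocalState (set_stopped true (base (S v))) (fun _ => 0) (fun _ => 0) else S v.
  move=> hv; rewrite /S' step_on ?hv //= (inv_deg I) all_ports.
  congr (if _ || _ then _ else _); apply: eq_forallb => u; case vu: (e v u) => //=.
  by rewrite rcv // eqb1 negb_and negbK.
have m v : mate (base (S' v)) = mate (base (S v)).
  case hv: (halt S v); first by rewrite /S' step_off.
  by rewrite SE //; case: ifP.
have same v : let z := base (S' v) in let z0 := base (S v) in
    (deg z, ident z, nbr_id z) = (deg z0, ident z0, nbr_id z0).
  case hv: (halt S v); first by rewrite /S' step_off.
  by rewrite SE //; case: ifP.
have un v : unmatched (S' v) = unmatched (S v) by rewrite /unmatched m.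
split=> // [|v hv].
  split=> [v|v|u v uv|u p|u v|v|v p].
  - by case: (same v) => d _ _; rewrite /dg d; exact: inv_deg.
  - by case: (same v) => _ -> _; exact: inv_id.
  - by case: (same u) => _ _ ->; exact: inv_nbr I _ _ uv.
  - by rewrite m; exact: inv_mate.
  - by rewrite /mates !m; exact: inv_sym I u v.
  - rewrite un; case hv: (halt S v) => hv'.
      by case: (inv_halt I hv) => h; [left | right=> u; rewrite un; exact: h].
    move: hv'; rewrite /halt SE //; case: ifP => [|_]; last by rewrite -/(halt S v) hv.
    case fv: (unmatched (S v)) => /=; last by left.
    move=> /forallP h _.
    right=> u vu; rewrite un; have := h u; rewrite vu /= => /orP[hu|//].
    (* A halted neighbour that is unmatched has only matched neighbours, contradicting that [v] is
       unmatched. *)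
    by case: (inv_halt I hu) => // /(_ v); rewrite e_sym vu fv => /(_ isT).
  - case hv: (halt S v); first by rewrite /S' step_off // => _; exact: inv_zero.
    by rewrite /halt SE //; case: ifP => // _; rewrite -/(halt S v) hv.
case hv': (halt S v); first by rewrite /S' /halt step_off.
rewrite /halt SE // ifT //; case: hv => [->//|h]; apply/orP; right.
by apply/forallP => u; apply/implyP => vu; rewrite h ?orbT.
Qed.

(** A guess that is too small still extends the matching consistently; under a sufficient guess all
    vertices pass the degree test, so saturation covers every edge and everyone halts. *)
Lemma phaseP (w cb l : nat) S0 : consistent S0 -> (forall v, id v < 2 ^ w) ->
  2 * w + 2 <= 2 ^ b -> 2 * w + 2 <= 2 ^ cb -> #|V|.+1 * 2 ^ (l + 3) < 2 ^ b ->
  let S := exec port b (phase #|V| w cb l) S0 in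
  consistent S /\ ((forall v, size (port v) <= 2 ^ l) ->
    (forall v, halt S v) /\ forall u v, e u v -> ~~ unmatched (S u) || ~~ unmatched (S v)).
Proof.
move=> I0 idw wb wcb bK; rewrite /phase exec_cat.
have b0 : 0 < b.
  by rewrite lt0n; apply: contraTneq wb => ->; rewrite -ltnNge expn0; lia.
set S1 := exec _ _ (if _ then _ else _) S0.
have [I1 E1 sat] : [/\ consistent S1, extends S0 S1 & saturated l S1].
  by rewrite /S1; case: ifP => _; [exact: port_by_portP | exact: thinning_iterP].
have [I2 m2 h2] := finishP b0 I1; set S2 := exec _ _ _ S1; rewrite -/S2 in I2 m2 h2.
split=> // small; have cov u v : e u v -> ~~ unmatched (S1 u) || ~~ unmatched (S1 v).
  wlog iuv : u v / id u < id v.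
    move=> H uv; case: (ltngtP (id u) (id v)) => [i|i|/id_inj E]; first exact: H.
      by rewrite orbC H // e_sym.
    by rewrite E e_irr in uv.
  move=> uv; have := sat u v; rewrite /active uv iuv /light !(inv_deg I1) !small !andbT /=.
  by rewrite negb_and.
split=> [v|u v uv]; last by rewrite /unmatched !m2; exact: cov.
apply: h2; case: (boolP (unmatched (S1 v))) => fv; [right=> u vu | by left].
by have := cov v u vu; rewrite fv.
Qed.

Lemma exchange_idsP : (forall v, id v < 2 ^ b) ->
  consistent (start id port |> exchange_ids).
Proof.
move=> idb; split=> // u v; last by rewrite /mates andbF.
by move=> uv; rewrite step_on //= receivedE //=; exact: idb.
Qed.

Lemma schedule_prefixP (w cb m : nat) : (forall v, id v < 2 ^ w) -> w <= b ->
  2 * w + 2 <= 2 ^ b -> 2 * w + 2 <= 2 ^ cb ->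
  (forall k, k <= m -> #|V|.+1 * 2 ^ (2 ^ k + 3) < 2 ^ b) ->
  (forall v, size (port v) <= 2 ^ (2 ^ m)) ->
  let S := exec port b (exchange_ids ::
    flatten [seq phase #|V| w cb (2 ^ k) | k <- iota 0 m.+1]) (start id port) in
  [/\ consistent S, forall v, halt S v
    & forall u v, e u v -> ~~ unmatched (S u) || ~~ unmatched (S v)].
Proof.
move=> idw wleb wb wcb bK small; set f := fun k => phase #|V| w cb (2 ^ k).
have idb v : id v < 2 ^ b by apply: leq_trans (idw v) _; rewrite leq_exp2l.
rewrite -cat1s exec_cat; have := exchange_idsP idb; rewrite -/(exec port b [:: exchange_ids] _).
set S1 := exec port b [:: exchange_ids] _ => I1.
have I k : k <= m.+1 -> consistent (exec port b (flatten [seq f k' | k' <- iota 0 k]) S1).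
  elim: k => [|k IH] km //; rewrite exec_iota.
  by have [] := phaseP (IH (ltnW km)) idw wb wcb (bK k km).
have [I2 /(_ small)[H C]] := phaseP (I m (leqnSn m)) idw wb wcb (bK m (leqnn m)).
by rewrite exec_iota.
Qed.

Definition mated_pairs S : {set {set V}} :=
  [set [set x.1; x.2] | x : V * V in [pred x | mates S x.1 x.2]].

Lemma mated_pairsE S u v : consistent S -> e u v ->
  ([set u; v] \in mated_pairs S) = mates S u v.
Proof.
move=> I uv; apply/imsetP/idP => [[[a c]]|m]; last by exists (u, v).
rewrite inE /= => m E; have /andP[ac _] := m.
have : u \in [set a; c] by rewrite -E set21.
have : v \in [set a; c] by rewrite -E set22.
rewrite !inE => /orP[]/eqP vE /orP[]/eqP uE; rewrite uE vE ?m //.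
- by rewrite uE vE e_irr in uv.
- exact: inv_sym I _ _ m.
- by rewrite uE vE e_irr in uv.
Qed.

Lemma mated_pairs_maximal S : consistent S ->
  (forall u v, e u v -> ~~ unmatched (S u) || ~~ unmatched (S v)) ->
  maximal_matching e (mated_pairs S).
Proof.
move=> I cov; split.
- apply/subsetP => f /imsetP[[a c]]; rewrite inE /= => /andP[ac _] ->.
  by apply/imsetP; exists (a, c).
- have pair u (x : V * V) : u \in [set x.1; x.2] -> mates S x.1 x.2 ->
      exists2 z, mates S u z & [set x.1; x.2] = [set u; z].
    case: x => c d /=; rewrite !inE => /orP[]/eqP -> m; first by exists d.
    by exists c; [exact: inv_sym I _ _ m | rewrite setUC].
  apply/trivIsetP => A B /imsetP[x xM ->] /imsetP[y yM ->] xy.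
  rewrite -setI_eq0; apply/eqP/setP => z; rewrite inE in_set0; apply/negP => /andP[zx zy].
  have [t mt tE] := pair z x zx xM; have [t' mt' tE'] := pair z y zy yM.
  by move: xy; rewrite tE tE' (mates_uniq mt mt') eqxx.
- have H u v : ~~ unmatched (S u) ->
      exists2 g, g \in mated_pairs S & ~~ [disjoint [set u; v] & g].
    case/(matched_mates I) => z m; exists [set u; z].
      by apply/imsetP; exists (u, z).
    by apply/pred0Pn; exists u; rewrite /= !inE eqxx.
  move=> f /imsetP[[a c]]; rewrite inE /= => ac ->.
  case/orP: (cov a c ac) => h; first exact: H.
  by rewrite setUC; exact: H.
Qed.

Lemma program_output S sched t : consistent S -> (forall v, halt S v) ->
  (forall v, (run id port (program b sched) t v).2 = S v) ->
  computes_edge_set id port (program b sched) t (mated_pairs S).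
Proof.
move=> I hS runE v; rewrite /= runE -/(halt S v) hS.
exists (fun i => mate (base (S v)) == Some i) => // i.
case/portP=> u vu <-; rewrite /pt nth_index ?mem_port // mated_pairsE // /mates vu.
by [].
Qed.

End Network.

(** * Round counts *)

Lemma size_flatten_const (T U : Type) (f : T -> seq U) (s : seq T) m :
  (forall x, size (f x) = m) -> size (flatten [seq f x | x <- s]) = size s * m.
Proof. by move=> fm; elim: s => //= x s IH; rewrite size_cat fm IH mulSn. Qed.

Lemma size_flatten_nseq (T : Type) (s : seq T) m : size (flatten (nseq m s)) = m * size s.
Proof. by elim: m => //= m IH; rewrite size_cat IH mulSn. Qed.

Lemma size_match_paths w cb : size (match_paths w cb) = (4 * cb).+1.
Proof.
rewrite /match_paths -cat1s size_cat (@size_flatten_const _ _ _ _ 2) // size_allpairs size_iota /=; lia.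
Qed.

(** The exact count is [4 * l ^ 2 + 27 * l + 44]. *)
Lemma size_thin_steps l : 0 < l -> size (thin_steps l) <= 75 * l ^ 2.
Proof.
move=> l0; rewrite /thin_steps !size_cat /=.
rewrite size_flatten_nseq (@size_flatten_const _ _ _ _ (4 * (l + 3)).+1) => [|i]; last first.
  by rewrite /rounding -cat1s size_cat (@size_flatten_const _ _ _ _ 2) // size_iota /=; lia.
rewrite size_iota -mulnn /=; nia.
Qed.

(** Either the number of port pairs times [cb] is at most [lg n], which pays for treating the pairs
    one by one, or [cb] is linear in [l] and matching the paths costs no more than thinning. *)
Lemma size_phase c n l w cb : 0 < l -> w = c * lg n -> cb = up_log 2 (2 * w + 2) ->
  size (phase n w cb l) <= (512 * (124 + 32 * c) + 1) * (l ^ 2 * lg n).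
Proof.
move=> l0 wE cbE.
have lg0 : 0 < lg n by rewrite /lg up_log_gt0; lia.
have cb0 : 0 < cb by rewrite cbE up_log_gt0; lia.
have l2 : 0 < l ^ 2 by rewrite expn_gt0 l0.
have lle : l <= l ^ 2 by rewrite -mulnn leq_pmulr.
have q0 : 0 < l ^ 2 * lg n by rewrite muln_gt0 l2.
rewrite /phase size_cat [leqLHS]addn1; case: ifP => [small|/negbT].
  rewrite /port_by_port (@size_flatten_const _ _ _ _ (4 * cb).+2) => [|x]; last first.
    by rewrite -cat1s size_cat size_match_paths.
  rewrite size_allpairs !size_iota.
  have -> : 2 ^ l * 2 ^ l = 4 ^ l by rewrite -expnMn.
  have : 4 ^ l * (4 * cb).+2 <= 6 * lg n.
    apply: leq_trans (_ : 6 * (4 ^ l * cb) <= _); last by rewrite leq_mul2l small orbT.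
    by rewrite mulnCA leq_mul2l; apply/orP; right; lia.
  have : lg n <= l ^ 2 * lg n by rewrite leq_pmull.
  move: (4 ^ l * _) (l ^ 2 * lg n) q0 => x y q0 h1 h2.
  apply: (@leq_trans (7 * y)); first by lia.
  by rewrite leq_mul2r; apply/orP; right; lia.
rewrite -ltnNge => big.
(* Here [2 ^ cb] is of order [lg n], which is below [4 ^ l * cb]. If [cb] exceeded the bound, then
   [cb = m + j] with [j > m] and [2 ^ j < cb < 2 * j], which is impossible. *)
have cbl : cb <= (8 * c + 12) * l.
  rewrite leqNgt; apply/negP => h.
  have h1 : 2 ^ cb.-1 < 2 * w + 2.
    have w2 : 1 < 2 * w + 2 by rewrite addn2.
    by rewrite cbE; case/andP: (up_log_bounds (isT : 1 < 2) w2).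
  pose m := 4 * c + 4 + 2 * l.
  have mcb : 2 * m < cb by apply: leq_trans h; rewrite /m; nia.
  have h2 : 2 ^ cb < 2 ^ m * cb.
    have -> : 2 ^ cb = 2 * 2 ^ cb.-1 by rewrite -expnS prednK.
    apply: (@leq_ltn_trans (4 * (c + 1) * lg n)).
      by apply: leq_trans (_ : 2 * (2 * w + 1) <= _); rewrite wE; nia.
    apply: (@leq_trans (4 * (c + 1) * (4 ^ l * cb))).
      by rewrite ltn_pmul2l //; lia.
    rewrite mulnA leq_mul2r /m expnD; apply/orP; right.
    have -> : 2 ^ (2 * l) = 4 ^ l by rewrite expnM.
    rewrite leq_mul2r; apply/orP; right.
    by apply: leq_trans (ltnW (ltn_expl _ (isT : 1 < 2))) _; rewrite leq_exp2l //; lia.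
  have [j jE] : exists j, cb = m + j by exists (cb - m); lia.
  have jm : m < j by lia.
  have : 2 ^ j < cb by move: h2; rewrite {1}jE expnD ltn_pmul2l ?expn_gt0.
  have : 2 * j <= 2 ^ j.
    by case: (j) => // k; rewrite expnS leq_mul2l /=; exact: ltn_expl.
  lia.
rewrite size_flatten_nseq.
(* The constant is 75 for thinning plus [4 * (8 * c + 12) + 1] for matching the paths. *)
have ts : size (thinning w cb l) <= (124 + 32 * c) * l ^ 2.
  rewrite /thinning size_cat size_match_paths; have := size_thin_steps l0.
  have : cb <= (8 * c + 12) * l ^ 2 by apply: leq_trans cbl _; rewrite leq_mul2l lle orbT.
  move: (l ^ 2) l2 => x x0; nia.
have : (256 * (lg n).+1) * size (thinning w cb l) <= (512 * lg n) * ((124 + 32 * c) * l ^ 2).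
  by apply: leq_mul => //; lia.
rewrite mulnACA [lg n * _]mulnC => h; apply: leq_ltn_trans h _.
by rewrite [X in _ < X]mulnDl mul1n -[X in X < _]addn0 ltn_add2l.
Qed.

Lemma exp2_up_log m : 0 < m -> m <= 2 ^ up_log 2 m <= 2 * m.
Proof.
move=> m0; rewrite up_logP //=; case: (ltngtP m 1) => [|m1|->]; [by lia | | by rewrite up_log1].
have /andP[h _] := up_log_bounds (isT : 1 < 2) m1.
have u0 : 0 < up_log 2 m by rewrite up_log_gt0 m1.
by rewrite -(prednK u0) expnS leq_mul2l ltnW.
Qed.

Lemma lg_gt0 n : 0 < lg n.
Proof. by rewrite /lg up_log_gt0 /=; lia. Qed.

Lemma leq_exp_lg n : n <= 2 ^ lg n.
Proof. by apply: leq_trans (up_logP _ _) => //; exact: leq_maxr. Qed.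

Lemma lg_leq m n : m <= n -> lg m <= lg n.
Proof. by move=> mn; apply: leq_up_log => //; rewrite geq_max leq_maxl leq_max mn orbT. Qed.

(** The costs form a geometric series of ratio 4, bounded by twice the last term. *)
Lemma sum_size_phases c n w cb m : w = c * lg n -> cb = up_log 2 (2 * w + 2) ->
  size (flatten [seq phase n w cb (2 ^ k) | k <- iota 0 m.+1]) <=
  (512 * (124 + 32 * c) + 1) * (2 * (4 ^ m * lg n)).
Proof.
move=> wE cbE; elim: m => [|m IH].
  rewrite /= cats0; apply: leq_trans (size_phase _ wE cbE) _ => //.
  by rewrite !expn0 exp1n leq_mul2l; apply/orP; right; lia.
rewrite -[m.+2]addn1 iotaD map_cat flatten_cat size_cat /= cats0.
apply: leq_trans (leq_add IH (size_phase _ wE cbE)) _; first by rewrite expn_gt0.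
rewrite add0n -mulnDr leq_mul2l; apply/orP; right.
have -> : (2 ^ m.+1) ^ 2 = 4 * 4 ^ m by rewrite -expnM mulnC expnM -expnS.
rewrite expnS; lia.
Qed.

Theorem theorem4p9 (c : nat) :
  exists (B C : nat) (A : forall n : nat, node_program (B * lg n)),
  forall (V : finType) (e : rel V) (id : V -> nat) (port : V -> seq V),
    simple_graph e -> valid_ids id c -> valid_ports e port ->
    exists (t : nat) (M : {set {set V}}),
      [/\ t <= C * (lg (max_degree e) ^ 2 * lg #|V|),
          computes_edge_set id port (A #|V|) t M
        & maximal_matching e M].
Proof.
(* Identifiers take [c * lg n] bits, and in-sums at most [3 * lg n + 4], since [2 ^ k <= 2 * lg n];
   nine more [lg n] suffice. The factor 8 is 2 from the geometric series times 4 from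
   [2 ^ m <= 2 * lg D], and the last 1 counts the exchange of identifiers. *)
exists (c + 9), ((512 * (124 + 32 * c) + 1) * 8 + 1).
exists (fun n => program ((c + 9) * lg n) (schedule c n)).
move=> V e id port [e_sym e_irr] [id_inj id_small] port_ok.
set n := #|V|; set b := (c + 9) * lg n; set D := max_degree e.
pose w := c * lg n; pose cb := up_log 2 (2 * w + 2); pose m := up_log 2 (lg D).
pose phases := fun k => phase n w cb (2 ^ k).
pose prefix := exchange_ids :: flatten [seq phases k | k <- iota 0 m.+1].
have lg0 := lg_gt0 n.
have degD v : size (port v) <= D.
  have [pu pe] := port_ok v; apply: leq_trans (leq_bigmax v) => /=.
  by rewrite -(card_uniqP pu); apply: eq_leq; apply: eq_card => u; rewrite pe.
have Dn : D <= n by apply/bigmax_leqP => v _; exact: max_card.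
have /andP[mlo mhi] := exp2_up_log (lg_gt0 D); rewrite -/m in mlo mhi.
have mK : m <= up_log 2 (lg n) by apply: leq_up_log; exact: lg_leq.
(* The schedule depends on [n] alone; the round bound in terms of [D] comes from the prefix that
   ends with the first sufficient guess, after which all nodes have halted. *)
have schedE : exists rest, schedule c n = prefix ++ rest.
  rewrite /schedule -/w -/cb -(subnKC (_ : m.+1 <= (up_log 2 (lg n)).+1)) //.
  by rewrite iotaD map_cat flatten_cat; eexists; reflexivity.
have [rest sE] := schedE.
have idw v : id v < 2 ^ w := id_small v.
have wb : w <= b by rewrite leq_mul2r leq_addr orbT.
have w2 : 2 * w + 2 <= 2 ^ w.+1.
  by rewrite expnS -[X in _ + X]muln1 -mulnDr leq_mul2l /= addn1 ltn_expl.
have [I H cov] : let S := exec port b prefix (start id port) in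
   [/\ consistent e id port S, forall v, halt S v
     & forall u v, e u v -> ~~ unmatched (S u) || ~~ unmatched (S v)].
  apply: schedule_prefixP => // [||k km|v].
  - by apply: leq_trans w2 _; rewrite leq_exp2l // /b /w mulnDl; lia.
  - have w0 : 0 < 2 * w + 2 by rewrite addn2.
    by case/andP: (exp2_up_log w0).
  - have n1 : n.+1 <= 2 ^ (lg n).+1.
      by apply: leq_trans (_ : (2 ^ lg n).+1 <= _); rewrite ?ltnS ?leq_exp_lg // ltn_exp2l.
    apply: leq_ltn_trans (leq_mul n1 (leqnn _)) _; rewrite -expnD ltn_exp2l //.
    have : 2 ^ k <= 2 * lg n.
      have /andP[_] := exp2_up_log lg0; apply: leq_trans.
      by rewrite leq_exp2l // (leq_trans km).
    rewrite /b mulnDl; lia.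
  - apply: leq_trans (degD v) _; apply: leq_trans (leq_exp_lg D) _.
    by rewrite leq_exp2l.
exists (size prefix), (mated_pairs e port (exec port b prefix (start id port))).
split; last exact: (mated_pairs_maximal port_ok I cov).
  have /= := sum_size_phases m (erefl w) (erefl cb); rewrite -/n -/phases => le.
  apply: (@leq_trans ((512 * (124 + 32 * c) + 1) * (2 * (4 ^ m * lg n)) + 1)).
    by rewrite addn1 ltnS.
  have h : 4 ^ m * lg n <= 4 * (lg D ^ 2 * lg n).
    rewrite mulnA leq_mul2r; apply/orP; right.
    by rewrite (_ : 4 = 2 ^ 2) // -expnM mulnC expnM -expnMn leq_exp2r.
  rewrite [leqRHS]mulnDl mul1n; apply: leq_add; last by rewrite muln_gt0 expn_gt0 lg_gt0.
  by rewrite -mulnA leq_mul2l; apply/orP; right; lia.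
apply: (program_output e_irr port_ok I H) => v.
have [|-> _] := @run_exec V id port b (schedule c n) (size prefix) _ v.
  by rewrite sE size_cat leq_addr.
by rewrite sE take_size_cat.
Qed.
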